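(* For any $\epsilon>0$ there exists a constant $C_\epsilon$ such that for any $0\le u\in S^2_1(S^{2n+1},\theta_0)$ satisfying $$\int_{S^{2n+1}}x_iu^{2+\frac2n}dV_{\theta_0}=\int_{S^{2n+1}}\overline x_iu^{2+\frac2n}dV_{\theta_0}=0\quad\text{for all }i=1,\dots,n+1,$$ where $x=(x_1,\dots,x_{n+1})\in S^{2n+1}\subset\mathbb C^{n+1}$, one has $$Y(S^{2n+1},\theta_0)\left(\int_{S^{2n+1}}u^{2+\frac2n}dV_{\theta_0}\right)^{\frac n{n+1}}\le\left(2^{-\frac1{n+1}}\cdot\frac{2n+2}n+\epsilon\right)\int_{S^{2n+1}}|\nabla_{\theta_0}u|^2_{\theta_0}dV_{\theta_0}+C_\epsilon\int_{S^{2n+1}}u^2dV_{\theta_0}.$$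
   Context: Let $n\ge1$, $S^{2n+1}=\{x\in\mathbb C^{n+1}:|x|=1\}$ with its standard CR structure and contact form $\theta_0=\sqrt{-1}\sum_{j=1}^{n+1}(x_jd\bar x_j-\bar x_jdx_j)$, $dV_{\theta_0}=\theta_0\wedge d\theta_0^n$. $\nabla_{\theta_0}$ is the sub-gradient and $\langle\cdot,\cdot\rangle_{\theta_0}$ the Levi form, normalized so that the sub-Laplacian defined by $\int(\Delta_{\theta_0}\phi)\psi\,dV_{\theta_0}=-\int\langle\nabla_{\theta_0}\phi,\nabla_{\theta_0}\psi\rangle_{\theta_0}dV_{\theta_0}$ satisfies $-\Delta_{\theta_0}x_j=\frac n2x_j$ (equivalently, $\langle\nabla_{\theta_0}\phi,\nabla_{\theta_0}\psi\rangle_{\theta_0}$ is one quarter of the round inner product of the projections to $\ker\theta_0$ of the round gradients). $S^2_1(S^{2n+1},\theta_0)$ is the Folland–Stein space, the completion of $C^1(S^{2n+1})$ in the norm $\left(\int(|\nabla_{\theta_0}u|^2_{\theta_0}+u^2)dV_{\theta_0}\right)^{1/2}$. The CR Yamabe invariant is $Y(S^{2n+1},\theta_0)=\inf_{u\not\equiv0}\int\left((2+\frac2n)|\nabla_{\theta_0}u|^2_{\theta_0}+R_{\theta_0}u^2\right)dV_{\theta_0}\big/(\int|u|^{2+\frac2n}dV_{\theta_0})^{\frac n{n+1}}$ over $u\in S^2_1(S^{2n+1},\theta_0)$, where $R_{\theta_0}=\frac{n(n+1)}2$; it equals $R_{\theta_0}\mathrm{Vol}(S^{2n+1},\theta_0)^{\frac1{n+1}}$.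 *)

(* Defs.v *)
From HB Require Import structures.
From mathcomp Require Import all_boot all_order all_algebra fingroup perm complex.
From mathcomp Require Import ring.
From mathcomp Require Import all_classical all_reals all_analysis measurable_realfun.
Set Implicit Arguments.
Unset Strict Implicit.
Unset Printing Implicit Defensive.
Import Order.TTheory GRing.Theory Num.Theory.
Import numFieldNormedType.Exports.
Local Open Scope classical_set_scope.
Local Open Scope ring_scope.

Fact rV_display : measure_display. Proof. exact: default_measure_display. Qed.

(* 'rV[R]_m carries the sigma-algebra generated by the coordinates, which is
   the Borel one. *)
Section measurable_rV.
Context {R : realType} {m : nat}.

Let rV_measurable : set (set 'rV[R]_m) :=
  g_sigma_preimage (fun (i : 'I_m) (x : 'rV[R]_m) => x 0 i : measurableTypeR R).

Let rV_measurable0 : rV_measurable set0.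
Proof. exact: sigma_algebra0. Qed.

Let rV_measurableC A : rV_measurable A -> rV_measurable (~` A).
Proof. exact: sigma_algebraC. Qed.

Let rV_measurable_bigcup (F : (set 'rV[R]_m)^nat) :
  (forall i, rV_measurable (F i)) -> rV_measurable (\bigcup_i F i).
Proof. exact: sigma_algebra_bigcup. Qed.

HB.instance Definition _ := @isMeasurable.Build rV_display 'rV[R]_m
  rV_measurable rV_measurable0 rV_measurableC rV_measurable_bigcup.

Lemma measurable_rV_coord (i : 'I_m) :
  measurable_fun [set: 'rV[R]_m] (fun x : 'rV[R]_m => x 0 i).
Proof.
move=> _ Y mY; rewrite setTI; apply: sub_sigma_algebra => /=.
rewrite -bigcup_seq/=; exists i => /=; first by rewrite mem_index_enum.
by exists Y => //; rewrite setTI.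
Qed.

Lemma measurable_rVP d (T : measurableType d) (f : T -> 'rV[R]_m) :
  (forall i, measurable_fun [set: T] (fun x => f x 0 i)) ->
  measurable_fun [set: T] f.
Proof.
move=> mf _ Y mY; rewrite setTI.
suff : rV_measurable `<=` [set A | measurable (f @^-1` A)] by exact.
apply: smallest_sub.
  split => /=; first by rewrite preimage_set0.
  - by move=> A mA; rewrite setTD preimage_setC; exact: measurableC.
  - by move=> F mF; rewrite preimage_bigcup; exact: bigcup_measurable.
move=> A; rewrite -bigcup_seq/= => -[i _ [B mB <-]].
by rewrite setTI; have := mf i measurableT _ mB; rewrite setTI.
Qed.

End measurable_rV.

Section lebesgue_rV.
Context {R : realType}.

Definition rV_cons m (p : measurableTypeR R * 'rV[R]_m) : 'rV[R]_m.+1 :=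
  row_mx (p.1%:M : 'rV_1) p.2.

Lemma rV_cons0 m p : @rV_cons m p 0 ord0 = p.1.
Proof.
have := row_mxEl (p.1%:M : 'rV[R]_1) p.2 0 ord0.
rewrite [RHS]mxE eqxx mulr1n => <-; rewrite /rV_cons.
by congr (fun_of_matrix _ _ _); exact: val_inj.
Qed.

Lemma rV_consS m p j : @rV_cons m p 0 (lift ord0 j) = p.2 0 j.
Proof.
have <- := row_mxEr (p.1%:M : 'rV[R]_1) p.2 0 j; rewrite /rV_cons.
by congr (fun_of_matrix _ _ _); exact: val_inj.
Qed.

Lemma measurable_rV_cons m : measurable_fun setT (@rV_cons m).
Proof.
apply: measurable_rVP => i; case: (unliftP ord0 i) => [j|] ->.
  under eq_fun do rewrite rV_consS.
  exact: (measurableT_comp (measurable_rV_coord j) measurable_snd).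
under eq_fun do rewrite rV_cons0.
exact: measurable_fst.
Qed.

Section step.
Variables (m : nat) (mu : {sigma_finite_measure set 'rV[R]_m -> \bar R}).

Definition lebesgue_rV_step (A : set 'rV[R]_m.+1) : \bar R :=
  ((@lebesgue_measure R) \x mu)%E (@rV_cons m @^-1` A).

Let step0 : lebesgue_rV_step set0 = 0%E.
Proof. by rewrite /lebesgue_rV_step preimage_set0 measure0. Qed.

Let step_ge0 A : (0 <= lebesgue_rV_step A)%E.
Proof. exact: measure_ge0. Qed.

Let step_sigma_additive : semi_sigma_additive lebesgue_rV_step.
Proof.
move=> F mF tF mUF; rewrite /lebesgue_rV_step preimage_bigcup.
have mcons A : measurable A -> measurable (@rV_cons m @^-1` A).
  by move=> mA; rewrite -[X in measurable X]setTI; exact: measurable_rV_cons.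
apply: measure_semi_sigma_additive.
- by move=> k; exact: mcons.
- apply/trivIsetP => /= i j _ _ ij; rewrite -preimage_setI.
  by move/trivIsetP : tF => /(_ _ _ _ _ ij) ->//; rewrite preimage_set0.
- by rewrite -preimage_bigcup; exact: mcons.
Qed.

HB.instance Definition _ := isMeasure.Build _ _ _ lebesgue_rV_step
  step0 step_ge0 step_sigma_additive.

Let step_sigma_finite : sigma_finite setT lebesgue_rV_step.
Proof.
have [F FT Foo] : sigma_finite setT ((@lebesgue_measure R) \x mu)%E.
  have /sigma_finiteP[F [TF ndF Foo]] := sigma_finiteT (@lebesgue_measure R).
  have /sigma_finiteP[G [TG ndG Goo]] := sigma_finiteT mu.
  exists (fun k => F k `*` G k).
    rewrite -setXTT TF TG predeqE => -[x y]; split.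
      move=> [/= [k _ Fkx] [l _ Gly]]; exists (maxn k l) => //; split.
      - by move: x Fkx; exact/subsetPset/ndF/leq_maxl.
      - by move: y Gly; exact/subsetPset/ndG/leq_maxr.
    by move=> [k _ []/= ? ?]; split; exists k.
  move=> k; have [? ?] := Foo k; have [? ?] := Goo k.
  split; first exact: measurableX.
  by rewrite product_measure1E// lte_mul_pinfty// ge0_fin_numE.
pose uncons (v : 'rV[R]_m.+1) : measurableTypeR R * 'rV[R]_m :=
  (v 0 0, \row_j v 0 (lift ord0 j)).
have unconsK : cancel (@rV_cons m) uncons.
  move=> [a w]; rewrite /uncons; congr pair; first by rewrite rV_cons0.
  by apply/rowP => j; rewrite mxE rV_consS.
have muncons : measurable_fun setT uncons.
  apply: measurable_fun_pair; first exact: measurable_rV_coord.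
  apply: measurable_rVP => i; under eq_fun do rewrite mxE.
  exact: measurable_rV_coord.
exists (fun k => uncons @^-1` (F k)).
  by rewrite -preimage_bigcup -FT preimage_setT.
move=> k; have [mF Fk] := Foo k; split.
  by rewrite -[X in measurable X]setTI; exact: muncons.
rewrite /lebesgue_rV_step -comp_preimage (_ : uncons \o _ = id)//.
by apply/funext => x /=; rewrite unconsK.
Qed.

HB.instance Definition _ := Measure_isSigmaFinite.Build _ _ _ lebesgue_rV_step
  step_sigma_finite.

End step.

Fixpoint lebesgue_rV (m : nat) : {sigma_finite_measure set 'rV[R]_m -> \bar R} :=
  if m is m'.+1 then lebesgue_rV_step (lebesgue_rV m') else \d_ (0 : 'rV[R]_0).

End lebesgue_rV.
Arguments lebesgue_rV : clear implicits.

Section meas_derivable.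
Context {R : realType}.

Definition meas_derivable m (f : 'rV[R]_m -> R) : Prop :=
  [/\ measurable_fun setT f, forall v, measurable_fun setT (fun t => 'D_v f t)
    & forall t v, derivable f t v].

Lemma meas_derivable_cst m (c : R) : @meas_derivable m (fun=> c).
Proof.
split=> [|v|t v]; first exact: measurable_cst.
  by under eq_fun do rewrite derive_cst; exact: measurable_cst.
exact: derivable_cst.
Qed.

Lemma meas_derivable_coord m (i : 'I_m) :
  meas_derivable (fun t : 'rV[R]_m => t 0 i).
Proof.
have cv (t v : 'rV[R]_m) :
    \forall h \near 0^', h^-1 *: ((h *: v + t) 0 i - t 0 i) = v 0 i.
  near=> h; rewrite !mxE addrK /GRing.scale/= mulKf//.
  by near: h; exact: nbhs_dnbhs_neq.
split=> [|v|t v]; first exact: measurable_rV_coord.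
  rewrite (_ : (fun t => 'D_v _ t) = cst (v 0 i)); first exact: measurable_cst.
  by apply/funext => t; apply: lim_near_cst; [|exact: cv].
exact: (is_cvg_near_cst (v 0 i) (cv t v)).
Unshelve. all: by end_near. Qed.

Lemma meas_derivableD m (f g : 'rV[R]_m -> R) :
  meas_derivable f -> meas_derivable g -> meas_derivable (fun t => f t + g t).
Proof.
move=> [mf mdf df] [mg mdg dg]; split=> [|v|t v].
- exact: measurable_funD.
- rewrite (_ : (fun t => 'D_v _ t) = ('D_v f : _ -> R) \+ 'D_v g).
    exact: measurable_funD.
  by apply/funext => t; exact: deriveD.
- exact: derivableD.
Qed.

Lemma meas_derivableM m (f g : 'rV[R]_m -> R) :
  meas_derivable f -> meas_derivable g -> meas_derivable (fun t => f t * g t).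
Proof.
move=> [mf mdf df] [mg mdg dg]; split=> [|v|t v].
- exact: measurable_funM.
- rewrite (_ : (fun t => 'D_v _ t) = (f \* ('D_v g : _ -> R)) \+ (g \* ('D_v f : _ -> R))).
    have m1 : measurable_fun setT (f \* ('D_v g : _ -> R)).
      exact: measurable_funM.
    have m2 : measurable_fun setT (g \* ('D_v f : _ -> R)).
      exact: measurable_funM.
    exact: (measurable_funD m1 m2).
  by apply/funext => t; exact: deriveM.
- exact: derivableM.
Qed.

Lemma meas_derivableV m (f : 'rV[R]_m -> R) : (forall t, 0 < f t) ->
  meas_derivable f -> meas_derivable (fun t => (f t)^-1).
Proof.
move=> f0 [mf mdf df].
have mV : measurable_fun setT (fun t => (f t)^-1).
  rewrite (_ : (fun t => _) = (fun t => f t `^ (- 1))).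
    exact: (measurableT_comp (measurable_powR _)).
  by apply/funext => t; rewrite powR_inv1// ltW.
split=> [//|v|t v].
- rewrite (_ : (fun t => 'D_v _ t) =
      (\- (((fun t => (f t)^-1) \* (fun t => (f t)^-1)) \* ('D_v f : _ -> R)))).
    by apply: measurable_funN; do 2 apply: measurable_funM => //.
  apply/funext => t; rewrite deriveV ?gt_eqF// /GRing.scale/=.
  by rewrite expr2 invfM mulNr.
- by apply: derivableV; rewrite ?gt_eqF.
Qed.

Lemma meas_derivable_sum m k (f : 'I_k -> 'rV[R]_m -> R) :
  (forall i, meas_derivable (f i)) ->
  meas_derivable (fun t => \sum_i f i t).
Proof.
elim: k f => [|k IH] f fd.
  rewrite (_ : (fun t => _) = fun=> 0); first exact: meas_derivable_cst.
  by apply/funext => t; rewrite big_ord0.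
rewrite (_ : (fun t => _) =
    (fun t => f ord0 t + \sum_(i < k) f (lift ord0 i) t)).
  by apply: meas_derivableD => //; exact: IH.
by apply/funext => t; rewrite big_ord_recl.
Qed.

End meas_derivable.

(* C^(n+1) is 'rV[R]_(n.+1 + n.+1), real parts first; functions, vector fields
   and the contact form of the sphere are given on this ambient space, and only
   their values on the sphere matter. *)
Section cr_sphere.
Context {R : realType} {n : nat}.
Local Notation V := 'rV[R]_(n.+1 + n.+1).
Implicit Types (x v w : V) (u phi : V -> R) (g : V -> V).

Definition dotv m (a b : 'rV[R]_m) : R := \sum_i a 0 i * b 0 i.

Definition normv m (a : 'rV[R]_m) : R := Num.sqrt (dotv a a).

Definition sphere : set V := [set x | normv x = 1].

Definition zcoord (j : 'I_n.+1) x : R[i] :=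
  (x 0 (lshift n.+1 j) +i* x 0 (rshift n.+1 j))%C.

Definition mul_i x : V := row_mx (- rsubmx x) (lsubmx x).

(* theta_0 = i \sum_j (x_j d\bar x_j - \bar x_j dx_j), evaluated at x on v *)
Definition theta0 x v : R :=
  complex.Re ('i * \sum_j (zcoord j x * conjc (zcoord j v)
                           - conjc (zcoord j x) * zcoord j v))%C.

Definition ext_derivative (a : V -> V -> R) x v w : R :=
  'D_v (fun y => a y w) x - 'D_w (fun y => a y v) x.

Definition dtheta0 : V -> V -> V -> R := ext_derivative theta0.

(* value on v of a /\ b^n for a 1-form a and a 2-form b, in the normalization
   (dx /\ dy)(d/dx, d/dy) = 1 *)
Definition wedge_pow (a : V -> R) (b : V -> V -> R)
    (v : 'I_(n + n).+1 -> V) : R :=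
  (2 ^+ n)^-1 * \sum_(s : 'S_(n + n).+1) (-1) ^+ s * (a (v (s ord0)) *
    \prod_(k < n) b (v (s (inord k.*2.+1))) (v (s (inord k.*2.+2)))).

(* inverse stereographic projection; its image is the sphere minus one point,
   so that it computes the integral of a top-degree form on the sphere *)
Definition stereo (t : 'rV[R]_(n.+1 + n)) : V :=
  (1 + dotv t t)^-1 *:
    row_mx (2 *: lsubmx t) (rV_cons (dotv t t - 1, 2 *: rsubmx t)).

(* density with respect to dt of the pull-back of theta_0 /\ dtheta_0^n, which
   vanishes nowhere and orients the sphere, whence the absolute value *)
Definition stereo_density (t : 'rV[R]_(n.+1 + n)) : R :=
  `|wedge_pow (theta0 (stereo t)) (dtheta0 (stereo t))
      (fun k => 'D_(delta_mx 0 k) stereo t)|.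

Definition dV (A : set V) : \bar R :=
  (\int[lebesgue_rV R (n.+1 + n)]_(t in stereo @^-1` A) (stereo_density t)%:E)%E.

(* Levi form, extended by the same formula to all ambient vectors *)
Definition levi x v w : R := dtheta0 x v (mul_i w).

Definition homog_ext phi : V -> R := fun y => phi ((normv y)^-1 *: y).

Definition C1_sphere phi : Prop :=
  forall x, x != 0 -> differentiable (homog_ext phi) x /\
    forall v, {for x, continuous (fun y => 'D_v (homog_ext phi) y)}.

Definition round_gradient phi x : V :=
  \row_i 'D_(delta_mx 0 i) (homog_ext phi) x.

(* mul_i x is orthogonal to the kernel of theta_0 at x *)
Definition horizontal_proj x v : V :=
  v - (theta0 x v / theta0 x (mul_i x)) *: mul_i x.

(* By leviE below the Levi form is 4 times the Euclidean inner product, hence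
   the factor 1/4; see levi_subgradient. The squared Levi length of the
   subgradient is thus 1/4 of the round one of the horizontal gradient. *)
Definition subgradient phi x : V :=
  4^-1 *: horizontal_proj x (round_gradient phi x).

Lemma theta0E x v : theta0 x v =
  2 * \sum_j (x 0 (lshift n.+1 j) * v 0 (rshift n.+1 j)
              - x 0 (rshift n.+1 j) * v 0 (lshift n.+1 j)).
Proof.
rewrite /theta0 mulr_sumr mulr_sumr (big_morph (@complex.Re R) (id1 := 0) (op1 := +%R)).
- by apply: eq_bigr => j _ /=; ring.
- by move=> [a b] [c d].
- by [].
Qed.

Lemma dtheta0E x v w : dtheta0 x v w = 2 * theta0 v w.
Proof.
have D (a : V -> R) y z : {morph a : c d / c + d} ->
    (forall r c, a (r *: c) = r * a c) -> 'D_z a y = a z.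
  move=> aD aZ; apply: lim_near_cst => //; near=> h.
  rewrite /= aD addrK aZ /GRing.scale/= mulKf//.
  by near: h; exact: nbhs_dnbhs_neq.
rewrite /dtheta0 /ext_derivative !D.
- rewrite !theta0E -mulrBr -sumrB; congr (2 * _); rewrite mulr_sumr.
  by apply: eq_bigr => j _; ring.
- move=> c d; rewrite !theta0E -mulrDr -big_split/=; congr (2 * _).
  by apply: eq_bigr => j _; rewrite !mxE; ring.
- move=> r c; rewrite !theta0E mulrCA; congr (2 * _); rewrite mulr_sumr.
  by apply: eq_bigr => j _; rewrite !mxE; ring.
- move=> c d; rewrite !theta0E -mulrDr -big_split/=; congr (2 * _).
  by apply: eq_bigr => j _; rewrite !mxE; ring.
- move=> r c; rewrite !theta0E mulrCA; congr (2 * _); rewrite mulr_sumr.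
  by apply: eq_bigr => j _; rewrite !mxE; ring.
Unshelve. all: by end_near. Qed.

Lemma leviE x v w : levi x v w = 4 * dotv v w.
Proof.
rewrite /levi dtheta0E theta0E mulrA -natrM /dotv big_split_ord/= -big_split/=.
congr (4 * _).
by apply: eq_bigr => j _; rewrite !(row_mxEl, row_mxEr) !mxE; ring.
Qed.

Lemma theta0_mul_i x v : theta0 x v = 2 * dotv (mul_i x) v.
Proof.
rewrite theta0E /dotv big_split_ord/= -big_split/=; congr (2 * _).
by apply: eq_bigr => j _; rewrite !(row_mxEl, row_mxEr) !mxE; ring.
Qed.

Lemma levi_subgradient phi x w : differentiable (homog_ext phi) x ->
  theta0 x w = 0 -> levi x (subgradient phi x) w = 'D_w (homog_ext phi) x.
Proof.
move=> dphi; rewrite theta0_mul_i => /eqP; rewrite mulf_eq0 pnatr_eq0/= => /eqP xw.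
rewrite leviE /subgradient /horizontal_proj.
set c := (_ / _).
have -> : dotv (4^-1 *: (round_gradient phi x - c *: mul_i x)) w =
    4^-1 * (dotv (round_gradient phi x) w - c * dotv (mul_i x) w).
  rewrite /dotv mulr_sumr -sumrB mulr_sumr; apply: eq_bigr => i _.
  by rewrite !mxE; ring.
rewrite xw mulr0 subr0 mulVKf ?pnatr_eq0// deriveE// [in RHS](row_sum_delta w).
rewrite linear_sum/=; apply: eq_bigr => i _.
by rewrite linearZ/= mxE deriveE// mulrC.
Qed.

Lemma meas_derivable_stereo i : meas_derivable (fun t => stereo t 0 i).
Proof.
have dd : meas_derivable (fun t : 'rV[R]_(n.+1 + n) => dotv t t).
  by apply: meas_derivable_sum => k; apply: meas_derivableM;
    exact: meas_derivable_coord.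
rewrite /stereo; under eq_fun do rewrite mxE.
apply: meas_derivableM.
  apply: meas_derivableV => [t|]; last first.
    by apply: meas_derivableD => //; exact: meas_derivable_cst.
  by rewrite ltr_wpDr// sumr_ge0// => k _; rewrite -expr2 sqr_ge0.
have mcoord k : meas_derivable (fun t : 'rV[R]_(n.+1 + n) => 2 * t 0 k).
  apply: meas_derivableM; first exact: meas_derivable_cst.
  exact: meas_derivable_coord.
case: (split_ordP i) => j ->.
  by under eq_fun do rewrite row_mxEl !mxE; exact: mcoord.
under eq_fun do rewrite row_mxEr.
case: (unliftP ord0 j) => [k|] ->.
  by under eq_fun do rewrite rV_consS !mxE; exact: mcoord.
under eq_fun do rewrite rV_cons0.
by apply: meas_derivableD => //; exact: meas_derivable_cst.
Qed.

Lemma measurable_stereo : measurable_fun setT stereo.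
Proof. by apply: measurable_rVP => i; case: (meas_derivable_stereo i). Qed.

Lemma measurable_stereo_density : measurable_fun setT stereo_density.
Proof.
have mD k i : measurable_fun setT (fun t => 'D_(delta_mx 0 k) stereo t 0 i).
  rewrite (_ : (fun t => _) =
      (fun t => 'D_(delta_mx 0 k) (fun t => stereo t 0 i) t)).
    by have [_ + _] := meas_derivable_stereo i; exact.
  apply/funext => t; rewrite derive_mx ?mxE//.
  apply/derivable_mxP => a j; rewrite (ord1 a).
  by have [_ _] := meas_derivable_stereo j; exact.
have mth (a b : 'rV[R]_(n.+1 + n) -> V) :
    (forall i, measurable_fun setT (fun t => a t 0 i)) ->
    (forall i, measurable_fun setT (fun t => b t 0 i)) ->
    measurable_fun setT (fun t => theta0 (a t) (b t)).
  move=> ma mb; under eq_fun do rewrite theta0E.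
  apply: measurable_funM => //; apply: measurable_sum => j.
  by apply: measurable_funB; exact: measurable_funM.
apply: measurableT_comp => //; apply: measurable_funM => //.
apply: measurable_sum => s; do 2 apply: measurable_funM => //.
  by apply: mth => // i; case: (meas_derivable_stereo i).
apply: measurable_prod => k _.
under eq_fun do rewrite dtheta0E.
by apply: measurable_funM => //; exact: mth.
Qed.

Let dV0 : dV set0 = 0%E.
Proof. by rewrite /dV preimage_set0 integral_set0. Qed.

Let dV_ge0 A : (0 <= dV A)%E.
Proof. by apply: integral_ge0 => t _; rewrite lee_fin normr_ge0. Qed.

Let dV_sigma_additive : semi_sigma_additive dV.
Proof.
move=> F mF tF mUF; rewrite /dV preimage_bigcup.
have mpre A : measurable A -> measurable (stereo @^-1` A).
  by move=> mA; rewrite -[X in measurable X]setTI; exact: measurable_stereo.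
have md : measurable_fun setT (fun t => (stereo_density t)%:E).
  by apply/measurable_EFinP; exact: measurable_stereo_density.
have d0 t : (0 <= (stereo_density t)%:E)%E by rewrite lee_fin normr_ge0.
apply: (@semi_sigma_additive_nng_induced _ _ _ (lebesgue_rV R (n.+1 + n))
  _ md d0 (fun k => stereo @^-1` F k)).
- by move=> k; exact: mpre.
- apply/trivIsetP => /= i j _ _ ij; rewrite -preimage_setI.
  by move/trivIsetP : tF => /(_ _ _ _ _ ij) ->//; rewrite preimage_set0.
- by rewrite -preimage_bigcup; exact: mpre.
Qed.

HB.instance Definition _ := isMeasure.Build _ _ _ dV
  dV0 dV_ge0 dV_sigma_additive.

End cr_sphere.
Arguments sphere R n : clear implicits.
Arguments dV R n : clear implicits.

Section folland_stein.
Context {R : realType} {n : nat}.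
Local Notation V := 'rV[R]_(n.+1 + n.+1).

(* The completion of C^1 in the S^2_1 norm is realized as the closure of
   { (phi, subgradient phi) | phi of class C^1 } in L^2 x L^2: an element is a
   function together with its subgradient, up to dV-a.e. equality. *)
Record folland_stein := FollandStein {
  fs_fun :> V -> R;
  fs_grad : V -> V;
  fs_measurable : measurable_fun (sphere R n) fs_fun;
  fs_grad_measurable : measurable_fun (sphere R n) fs_grad;
  fs_closure : exists phi : nat -> V -> R,
    (forall k, C1_sphere (phi k)) /\
    (\int[dV R n]_(x in sphere R n)
      (levi x (fs_grad x - subgradient (phi k) x)
              (fs_grad x - subgradient (phi k) x)
       + (fs_fun x - phi k x) ^+ 2)%:E @[k --> \oo] --> 0)%E }.

Implicit Type u : folland_stein.

Definition crit_exp : R := 2 + 2 / n%:R.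

Definition dirichlet_density u (x : V) : R := levi x (fs_grad u x) (fs_grad u x).

Definition webster_curvature : R := n%:R * n.+1%:R / 2.

Definition yamabe_quotient u : \bar R :=
  (\int[dV R n]_(x in sphere R n)
      (crit_exp * dirichlet_density u x + webster_curvature * u x ^+ 2)%:E
   / (\int[dV R n]_(x in sphere R n) (`|u x| `^ crit_exp)%:E)
       `^ (n%:R / n.+1%:R))%E.

Definition cr_yamabe_invariant : \bar R :=
  ereal_inf [set yamabe_quotient u | u in
    [set u : folland_stein | ~ {ae dV R n, forall x, u x = 0}]].

Definition sphere_cintegral (f : V -> R[i]) : R[i] :=
  (\int[dV R n]_(x in sphere R n) complex.Re (f x)
   +i* \int[dV R n]_(x in sphere R n) complex.Im (f x))%C.

End folland_stein.
Arguments folland_stein R n : clear implicits.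
Arguments crit_exp R n : clear implicits.
Arguments cr_yamabe_invariant R n : clear implicits.

(* Main.v *)
Require Import Defs.
From HB Require Import structures.
From mathcomp Require Import all_boot all_order all_algebra complex.
From mathcomp Require Import all_classical all_reals all_analysis.
From mathcomp Require Import measurable_realfun ring lra.

(** Write p = 2 + 2/n, theta = n/(n+1) = 2/p, Y for the CR Yamabe invariant and
    D for the integral of u^p.  By definition of Y as an infimum, every element
    v of the Folland-Stein space satisfies

      Y (int |v|^p)^theta <= int (p |grad v|^2 + R v^2),

    and this is the only Sobolev inequality used.  Applied to u itself it gives
    the coefficient p = (2n+2)/n; the gain 2^(-1/(n+1)) comes from applying it
    to pieces of u and adding up.

    A piece is F_a u for a C^1 cutoff 0 <= F_a <= 1 supported in a small subset
    of the sphere.  If a probability measure has barycenter 0, a set of small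
    diameter carries at most a little more than half of its mass: near a unit
    vector w the function 1 + <w, x> is almost 2, it is nonnegative elsewhere,
    and its integral is 1 ([localized_mass_le]).  So every piece has mass
    m_a <= D / (2 - kap), and since m^theta is concave in m, having many pieces
    instead of one costs energy: sum_a m_a^theta is at least
    (D / (2 - kap))^(theta - 1) sum_a m_a ([le_sum_powR]).

    For the sum to be efficient the cutoffs must satisfy both
    sum_a F_a^2 <= Lam, which bounds the total energy of the pieces by Lam times
    that of u up to a factor 1 + kap and a multiple of int u^2, and
    sum_a F_a^p >= (1 - kap) Lam, which says that almost no mass is lost.  A
    partition of unity, sum_a F_a^2 = 1, fails the second condition, as F_a^p is
    small compared with F_a^2 where the supports overlap.  Both hold if F_a is
    the indicator function of a cube up to a thin transition layer and a runs
    over all translates of that cube by a fine lattice: each point lies in the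
    same number of translates, and in the layer of only few of them
    ([localizing_family]).  The family is finite and depends on n and kap only,
    so the constants are uniform in u.

    Altogether Y D^theta (2 - kap)^(1 - theta) (1 - kap) Lam is at most
    p (1 + kap) Lam int |grad u|^2 + C int u^2, and kap tends to 0.  The rest is
    the verification that F_a u belongs to the Folland-Stein space
    ([fs_cutoff]). *)

Set Implicit Arguments.
Unset Strict Implicit.
Unset Printing Implicit Defensive.
Import Order.TTheory GRing.Theory Num.Theory.
Import numFieldNormedType.Exports.
Local Open Scope classical_set_scope.
Local Open Scope ring_scope.

(** * Functions of class C^1 away from the origin *)

Section C1_away0.
Context {R : realType} {m : nat}.
Local Notation V := 'rV[R]_m.
Implicit Types (f g : V -> R) (x v : V).

(** [C1_sphere phi] is convertible to [C1_away0 (homog_ext phi)]; the lemmas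
    below are therefore closure properties of [C1_sphere], stated without
    reference to the homogeneous extension. *)
Definition C1_away0 f : Prop :=
  forall x, x != 0 -> differentiable f x /\
    forall v, {for x, continuous (fun y => 'D_v f y)}.

Lemma continuous_away0 f g x : x != 0 -> (forall y, y != 0 -> f y = g y) ->
  {for x, continuous g} -> {for x, continuous f}.
Proof.
move=> x0 fg; rewrite /prop_for /continuous_at fg// => gx.
have near0 : \forall y \near nbhs x, y != 0.
  exact: (@cvgr_neq0 R V V (nbhs x) _ idfun x cvg_id x0).
apply: cvg_trans gx; apply: (@near_eq_cvg _ _ (nbhs x)).
by apply: filterS near0 => y y0; rewrite fg.
Qed.

Lemma C1_away0_cst (c : R) : C1_away0 (fun=> c).
Proof.
move=> x x0; split=> [|v]; first exact: differentiable_cst.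
apply: (@continuous_away0 _ (fun=> 0)) => // [y _|]; first exact: derive_cst.
exact: cst_continuous.
Qed.

Lemma C1_away0D f g : C1_away0 f -> C1_away0 g -> C1_away0 (f + g).
Proof.
move=> cf cg x x0; have [df cdf] := cf _ x0; have [dg cdg] := cg _ x0.
split=> [|v]; first exact: differentiableD.
apply: (@continuous_away0 _ (fun y => 'D_v f y + 'D_v g y)) => // [y y0|].
  by rewrite deriveD//; apply: diff_derivable; [case: (cf y y0)|case: (cg y y0)].
by apply: continuousD; [exact: cdf|exact: cdg].
Qed.

Lemma C1_away0M f g : C1_away0 f -> C1_away0 g -> C1_away0 (f * g).
Proof.
move=> cf cg x x0; have [df cdf] := cf _ x0; have [dg cdg] := cg _ x0.
split=> [|v]; first exact: differentiableM.
apply: (@continuous_away0 _ (fun y => f y * 'D_v g y + g y * 'D_v f y)) => // [y y0|].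
  by rewrite deriveM//; apply: diff_derivable; [case: (cf y y0)|case: (cg y y0)].
have cf0 := differentiable_continuous df; have cg0 := differentiable_continuous dg.
by apply: continuousD; apply: continuousM.
Qed.

Lemma derive_comp_real f (h : R -> R) (l : R) x v : differentiable f x ->
  is_derive (f x) 1 h l -> 'D_v (h \o f) x = l * 'D_v f x.
Proof.
move=> df dh; have dh1 : differentiable h (f x).
  by apply/derivable1_diffP; exact: ex_derive.
rewrite deriveE; last exact: differentiable_comp.
rewrite diff_comp//= deriv1E; last exact: ex_derive.
by rewrite derive1E derive_val/= -deriveE// mulrC.
Qed.

Lemma C1_away0_comp f (h h' : R -> R) : C1_away0 f ->
  (forall x, x != 0 -> is_derive (f x) 1 h (h' (f x))) ->
  (forall x, x != 0 -> {for f x, continuous h'}) -> C1_away0 (h \o f).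
Proof.
move=> cf dh ch x x0; have [df cdf] := cf _ x0; split=> [|v].
  apply: differentiable_comp => //; apply/derivable1_diffP.
  by have ? := dh _ x0; exact: ex_derive.
apply: (@continuous_away0 _ (fun y => h' (f y) * 'D_v f y)) => // [y y0|].
  apply: derive_comp_real; [by case: (cf y y0)|exact: dh].
apply: continuousM; last exact: cdf.
apply: (continuous_comp (differentiable_continuous df)); exact: ch.
Qed.

Lemma C1_away0_prod k (f : 'I_k -> V -> R) :
  (forall i, C1_away0 (f i)) -> C1_away0 (fun x => \prod_i f i x).
Proof.
elim: k f => [|k IH] f cf.
  rewrite (_ : (fun x => _) = fun=> 1); first exact: C1_away0_cst.
  by apply/funext => x; rewrite big_ord0.
rewrite (_ : (fun x => _) =
    f ord0 * (fun x => \prod_(i < k) f (lift ord0 i) x)).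
  by apply: C1_away0M => //; exact: IH.
by apply/funext => x; rewrite big_ord_recl.
Qed.

Lemma C1_away0_sum k (f : 'I_k -> V -> R) :
  (forall i, C1_away0 (f i)) -> C1_away0 (fun x => \sum_i f i x).
Proof.
elim: k f => [|k IH] f cf.
  rewrite (_ : (fun x => _) = fun=> 0); first exact: C1_away0_cst.
  by apply/funext => x; rewrite big_ord0.
rewrite (_ : (fun x => _) =
    f ord0 + (fun x => \sum_(i < k) f (lift ord0 i) x)).
  by apply: C1_away0D => //; exact: IH.
by apply/funext => x; rewrite big_ord_recl.
Qed.

Lemma C1_away0_coord (i : 'I_m) : C1_away0 (fun x : V => x 0 i).
Proof.
move=> x x0; split=> [|v]; first exact: differentiable_coord.
apply: (@continuous_away0 _ (fun=> v 0 i)) => // [y _|]; last exact: cst_continuous.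
apply: lim_near_cst => //; near=> h; rewrite /= !mxE addrK /GRing.scale/= mulKf//.
by near: h; exact: nbhs_dnbhs_neq.
Unshelve. all: by end_near. Qed.

Lemma dotv_ge0 x : 0 <= dotv x x.
Proof. by apply: sumr_ge0 => i _; rewrite -expr2 sqr_ge0. Qed.

Lemma dotv_gt0 x : x != 0 -> 0 < dotv x x.
Proof.
move=> x0; rewrite lt_neqAle dotv_ge0 andbT eq_sym.
apply: contra x0 => /eqP xx; apply/eqP/rowP => i; rewrite mxE.
apply/eqP; rewrite -sqrf_eq0 expr2; apply/eqP.
apply: (psumr_eq0P (P := xpredT) (F := fun i => x 0 i * x 0 i)) => // j _.
by rewrite -expr2 sqr_ge0.
Qed.

Lemma C1_away0_normvV : C1_away0 (fun x : V => (normv x)^-1).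
Proof.
have cd : C1_away0 (fun x : V => dotv x x).
  apply: C1_away0_sum => i.
  by apply: (@C1_away0M (fun x : V => x 0 i) (fun x : V => x 0 i));
    exact: C1_away0_coord.
pose h (s : R) := (Num.sqrt s)^-1.
pose h' (s : R) : R := - (Num.sqrt s) ^- 2 * (2 * Num.sqrt s)^-1.
apply: (@C1_away0_comp _ h h' cd) => x /dotv_gt0 x0.
  have s0 : Num.sqrt (dotv x x) != 0 by rewrite gt_eqF// sqrtr_gt0.
  have ? := is_derive1_sqrt x0.
  apply: is_derive_eq; first exact: is_deriveV.
  by [].
have s0 : Num.sqrt (dotv x x) != 0 by rewrite gt_eqF// sqrtr_gt0.
have cs := @sqrt_continuous R (dotv x x).
apply: continuousM.
  apply: continuousN; apply: continuousV; first by rewrite expf_neq0.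
  exact: (continuous_comp cs (@exprn_continuous _ _ _)).
apply: continuousV; first by rewrite mulf_neq0.
by apply: continuousM => //; exact: cst_continuous.
Qed.

End C1_away0.

(** A directional derivative is the pointwise limit of the difference quotients
    with steps 1/(k+1), so that continuity of the derivative need not be related
    to the coordinate sigma-algebra. *)
Lemma measurable_derive (R : realType) m (f : 'rV[R]_m -> R) (v : 'rV[R]_m)
    (D : set 'rV[R]_m) : measurable D ->
  measurable_fun setT f -> (forall x, D x -> derivable f x v) ->
  measurable_fun D (fun x => 'D_v f x).
Proof.
move=> mD mf df; pose e (k : nat) : R := k.+1%:R^-1.
apply: (@measurable_fun_cvg _ _ _ D
  (fun k x => (e k)^-1 * (f (e k *: v + x) - f x))).
  move=> k; apply: measurable_funTS; apply: measurable_funM => //.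
  apply: measurable_funB => //; apply: (measurableT_comp mf).
  apply: measurable_rVP => i; under eq_fun do rewrite !mxE.
  by apply: measurable_funD => //; exact: measurable_rV_coord.
move=> x Dx; have /cvgr_dnbhsP := df x Dx; apply; split.
  by move=> k; rewrite invr_eq0 pnatr_eq0.
exact: cvg_harmonic.
Qed.

(** * A C^1 step and its lattice translates *)

Section smooth_step.
Context {R : realType}.
Implicit Types t : R.

(** The square of the positive part of t, in a form whose derivative t + |t| is
    visibly continuous. *)
Definition sq_pos t : R := t * (t + `|t|) / 2.

Lemma sq_pos_ge t : 0 <= t -> sq_pos t = t ^+ 2.
Proof. by move=> t0; rewrite /sq_pos ger0_norm//; field. Qed.

Lemma sq_pos_le t : t <= 0 -> sq_pos t = 0.
Proof. by move=> t0; rewrite /sq_pos ler0_norm// subrr mulr0 mul0r. Qed.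

Lemma is_derive_sq_pos t : is_derive t 1 sq_pos (t + `|t|).
Proof.
have [t0|t0|->] := ltgtP t 0.
- rewrite ltr0_norm// subrr; apply: (@near_eq_is_derive _ _ _ (cst 0)).
  by near=> y; rewrite sq_pos_le// ltW//; near: y; exact: lt_nbhsl.
- rewrite gtr0_norm//; apply: (@near_eq_is_derive R R^o R^o (fun y : R => y ^+ 2)).
    by near=> y; rewrite sq_pos_ge// ltW//; near: y; exact: lt_nbhsr.
  apply: is_derive_eq; rewrite /GRing.scale/=; ring.
- rewrite normr0 addr0.
  suff H : (fun h => h^-1 *: ((sq_pos \o shift 0) (h *: 1) - sq_pos 0)) @ 0^' --> (0 : R).
    by split; [apply/cvg_ex; exists 0|exact: cvg_lim].
  have E : \forall h \near (0 : R)^', (h + `|h|) / 2 =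
      h^-1 *: ((sq_pos \o shift 0) (h *: 1) - sq_pos 0).
    near=> h; rewrite /= addr0 [h *: 1]mulr1 (sq_pos_le (lexx 0)) subr0.
    rewrite /GRing.scale/= /sq_pos -mulrA mulKf//.
    by near: h; exact: nbhs_dnbhs_neq.
  apply: cvg_trans; first exact: (near_eq_cvg E).
  apply: cvg_within_filter.
  have : {for (0 : R), continuous (fun h : R => (h + `|h|) / 2)}.
    apply: continuousM; last exact: cst_continuous.
    by apply: continuousD => //; exact: norm_continuous.
  by rewrite /prop_for /continuous_at normr0 addr0 mul0r.
Unshelve. all: by end_near. Qed.

Lemma continuous_sq_pos' : continuous (fun t => t + `|t|).
Proof. by move=> t; apply: continuousD => //; exact: norm_continuous. Qed.

(** The second primitive of the function equal to 4 on [0, 1/2], to -4 on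
    [1/2, 1] and to 0 elsewhere: a C^1 passage from 0 to 1 on the unit interval. *)
Definition step t : R := 2 * sq_pos t - 4 * sq_pos (t - 2^-1) + 2 * sq_pos (t - 1).

Lemma step_le0 t : t <= 0 -> step t = 0.
Proof. by move=> t0; rewrite /step !sq_pos_le; lra. Qed.

Lemma step_ge1 t : 1 <= t -> step t = 1.
Proof. by move=> t1; rewrite /step !sq_pos_ge; [field|lra..]. Qed.

Lemma step_itv t : 0 <= step t <= 1.
Proof.
have [t0|t0] := leP t 0; first by rewrite step_le0// lexx ler01.
have [t1|t1] := leP 1 t; first by rewrite step_ge1// lexx ler01.
rewrite /step (@sq_pos_ge t) ?(@sq_pos_le (t - 1)); [|lra..].
have [t2|t2] := leP t 2^-1; [rewrite sq_pos_le|rewrite sq_pos_ge]; [|lra| |lra].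
  by rewrite !mulr0 subr0 addr0; apply/andP; split; nra.
apply/andP; split; nra.
Qed.

Definition bump (l : nat) t : R := step t - step (t - l%:R).

Lemma bump_supp l t : bump l t != 0 -> 0 < t < l.+1%:R.
Proof.
apply: contraR; rewrite negb_and -!leNgt /bump => /orP[t0|tl].
  by rewrite !step_le0 ?subrr// (le_trans _ t0)// lerBlDr lerDl.
rewrite -natr1 in tl.
by rewrite !step_ge1 ?subrr//; have : (0 : R) <= l%:R := ler0n _ _; lra.
Qed.

Lemma bump_eq1 l t : 1 <= t <= l%:R -> bump l t = 1.
Proof.
by move=> /andP[t1 tl]; rewrite /bump step_ge1// step_le0 ?subr0// subr_le0.
Qed.

Lemma bump_itv l t : 0 <= bump l t <= 1.
Proof.
have /andP[s0 s1] := step_itv t; have /andP[s'0 s'1] := step_itv (t - l%:R).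
case: l s'0 s'1 => [|l] s'0 s'1; first by rewrite /bump subr0 subrr lexx ler01.
have [t1|t1] := leP 1 t; last first.
  by rewrite /bump [X in _ - X]step_le0 ?subr0 ?s0// -natr1;
    have : (0 : R) <= l%:R := ler0n _ _; lra.
by rewrite /bump (step_ge1 t1); lra.
Qed.

(** The difference of two sums over windows of length k, one of which is the
    other shifted by l, only sees the two ends. *)
Lemma telescope_shift (g : nat -> R) (k l : nat) :
  \sum_(j < k) (g j - g (j + l)%N) = \sum_(j < l) g j - \sum_(j < l) g (j + k)%N.
Proof.
elim: k => [|k IH].
  by rewrite big_ord0; under [X in _ - X]eq_bigr do rewrite addn0; rewrite subrr.
have E : \sum_(j < l) g (j + k)%N + g (l + k)%N =
    g k + \sum_(j < l) g (j + k.+1)%N.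
  transitivity (\sum_(j < l.+1) g (j + k)%N); first by rewrite big_ord_recr.
  by rewrite big_ord_recl; under eq_bigr do rewrite lift0 addSnnS.
by rewrite big_ord_recr/= IH [(k + l)%N]addnC; lra.
Qed.

(** Exactly l of the integer translates of [bump l], counted with weights, cover
    t: the transition layers of consecutive translates compensate each other. *)
Lemma sum_bump l k t : l%:R <= t -> t <= k%:R ->
  \sum_(j < k) bump l (t - j%:R) = l%:R.
Proof.
move=> lt tk; have -> : \sum_(j < k) bump l (t - j%:R) =
    \sum_(j < k) (step (t - j%:R) - step (t - (j + l)%N%:R)).
  by apply: eq_bigr => j _; congr (_ - step _); rewrite natrD; ring.
rewrite (telescope_shift (fun j => step (t - j%:R))).
have -> : \sum_(j < l) step (t - j%:R) = l%:R.
  rewrite (eq_bigr (fun=> 1)) ?sumr_const ?card_ord// => j _; apply: step_ge1.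
  rewrite lerBrDr (le_trans _ lt)// -[1]/(1%:R) -natrD ler_nat.
  exact: ltn_ord.
rewrite big1 ?subr0// => j _; apply: step_le0.
by rewrite subr_le0 (le_trans tk)// ler_nat leq_addl.
Qed.

(** [bump l.+2] is 1 on the support of the shorter bump centered at the same
    point.  Together with [sum_bump] this bounds from below the sum of any power
    of the translates of [bump l.+2]. *)
Lemma bump_inner l t : bump l (t - 1) != 0 -> bump l.+2 t = 1.
Proof.
move=> /bump_supp; rewrite -[l.+1%:R]natr1 => H.
by apply: bump_eq1; rewrite -[l.+2%:R]natr1 -[l.+1%:R]natr1; lra.
Qed.

End smooth_step.

Section C1_bump.
Context {R : realType} {m : nat}.
Local Notation V := 'rV[R]_m.
Implicit Types f : V -> R.

Lemma C1_away0_affine (a b : R) f : C1_away0 f ->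
  C1_away0 (fun x => a * f x + b).
Proof.
move=> cf; apply: (@C1_away0D _ _ (fun x => a * f x) (fun=> b)).
  by apply: (@C1_away0M _ _ (fun=> a) f) => //; exact: C1_away0_cst.
exact: C1_away0_cst.
Qed.

Lemma C1_away0_step f : C1_away0 f -> C1_away0 (fun x => step (f x)).
Proof.
move=> cf; have cp (c : R) : C1_away0 (fun x => sq_pos (f x - c)).
  apply: (@C1_away0_comp _ _ (fun x => f x - c) sq_pos (fun t => t + `|t|)).
  - apply: (@C1_away0D _ _ f (fun=> - c)) => //; exact: C1_away0_cst.
  - by move=> x _; exact: is_derive_sq_pos.
  - by move=> x _; exact: continuous_sq_pos'.
rewrite (_ : (fun x => _) = (fun x => 2 * sq_pos (f x - 0) + 0) +
    ((fun x => (- 4) * sq_pos (f x - 2^-1) + 0) +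
     (fun x => 2 * sq_pos (f x - 1) + 0))); last first.
  apply/funext => x; rewrite !fctE /step subr0; ring.
by apply: C1_away0D; [|apply: C1_away0D]; exact: C1_away0_affine.
Qed.

Lemma C1_away0_bump l f : C1_away0 f -> C1_away0 (fun x => bump l (f x)).
Proof.
move=> cf; rewrite (_ : (fun x => _) = (fun x => step (f x)) +
    (fun x => (- 1) * step (1 * f x + - l%:R) + 0)).
  apply: C1_away0D; first exact: C1_away0_step.
  by apply: C1_away0_affine; apply: C1_away0_step; exact: C1_away0_affine.
by apply/funext => x; rewrite !fctE /bump mul1r; ring.
Qed.

Lemma measurable_normv : measurable_fun setT (@normv R m).
Proof.
apply: (measurableT_comp (continuous_measurable_fun (@sqrt_continuous R))).
apply: measurable_sum => i.
by apply: measurable_funM; exact: measurable_rV_coord.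
Qed.

Lemma measurable_normvV : measurable_fun setT (fun x : V => (normv x)^-1).
Proof.
rewrite (_ : (fun x => _) = (fun x => normv x `^ (- 1))).
  exact: (measurableT_comp (measurable_powR _) measurable_normv).
by apply/funext => x; rewrite powR_inv1// sqrtr_ge0.
Qed.

End C1_bump.

Lemma measurable_bump (R : realType) l : measurable_fun setT (@bump R l).
Proof.
have cs : continuous (@sq_pos R).
  move=> t; apply/differentiable_continuous/derivable1_diffP.
  by case: (is_derive_sq_pos t).
have ms (c : R) : measurable_fun setT (fun t : R => t - c).
  by apply: measurable_funB.
have mstep : measurable_fun setT (@step R).
  have mp (c : R) : measurable_fun setT (fun t : R => sq_pos (t - c)).
    exact: (measurableT_comp (continuous_measurable_fun cs) (ms c)).
  apply: measurable_funD; last by apply: measurable_funM.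
  apply: measurable_funB; last by apply: measurable_funM.
  by apply: measurable_funM => //; exact: (continuous_measurable_fun cs).
by apply: measurable_funB => //; exact: (measurableT_comp mstep (ms _)).
Qed.

Section grid_bump.
Context {R : realType} {n : nat}.
Local Notation V := 'rV[R]_(n.+1 + n.+1).
Variables (l k N : nat).
Implicit Types (a : {ffun 'I_(n.+1 + n.+1) -> 'I_N}) (x : V).

(** On the sphere the coordinate x_i runs over [-1, 1]; stretching by k and
    translating puts it in the range where [sum_bump] applies to the bumps of
    length l and the translates 0, ..., 2 k + l - 1. *)
Definition grid_coord x i : R := k%:R * x 0 i + (k + l)%:R.

Definition grid_bump a x : R :=
  \prod_i bump l (grid_coord x i - (a i)%:R).

Lemma C1_sphere_grid_bump a : C1_sphere (grid_bump a).
Proof.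
suff : C1_away0 (homog_ext (grid_bump a)) by exact.
apply: C1_away0_prod => i; apply: C1_away0_bump.
rewrite (_ : (fun x => _) = (fun x : V =>
    k%:R * ((normv x)^-1 * x 0 i) + ((k + l)%:R - (a i)%:R))); last first.
  by apply/funext => x; rewrite /grid_coord mxE addrA.
apply: C1_away0_affine.
apply: (@C1_away0M _ _ (fun x : V => (normv x)^-1) (fun x : V => x 0 i)).
  exact: C1_away0_normvV.
exact: C1_away0_coord.
Qed.

Lemma measurable_homog_grid_bump a :
  measurable_fun setT (homog_ext (grid_bump a)).
Proof.
apply: measurable_prod => i _.
apply: (measurableT_comp (@measurable_bump R l)).
apply: measurable_funB => //; apply: measurable_funD => //.
apply: measurable_funM => //; under eq_fun do rewrite mxE.
apply: measurable_funM; [exact: measurable_normvV|exact: measurable_rV_coord].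
Qed.

Lemma grid_bump_itv a x : 0 <= grid_bump a x <= 1.
Proof.
rewrite /grid_bump prodr_ge0 => [|i _]; last by have /andP[] := bump_itv l (grid_coord x i - (a i)%:R).
apply: le_trans (_ : \prod_(i < n.+1 + n.+1) (1 : R) <= 1); last by rewrite big1.
by apply: ler_prod => i _; exact: bump_itv.
Qed.

Lemma sphere_coord_itv x i : sphere R n x -> -1 <= x 0 i <= 1.
Proof.
move=> sx; have xx : dotv x x = 1.
  by rewrite -[LHS]sqr_sqrtr ?dotv_ge0// [Num.sqrt _]sx expr1n.
rewrite -ler_norml -[X in _ <= X]sqrtr1 -sqrtr_sqr ler_sqrt// -xx.
rewrite /dotv (bigD1 i)//= -expr2 lerDl sumr_ge0// => j _.
by rewrite -expr2 sqr_ge0.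
Qed.

Lemma grid_coord_itv x i : sphere R n x ->
  l%:R <= grid_coord x i <= (k + k + l)%:R.
Proof.
move=> /(sphere_coord_itv i) xi; rewrite /grid_coord !natrD.
have : (0 : R) <= k%:R := ler0n _ _; nra.
Qed.

End grid_bump.

(** * The localizing family on the sphere *)

Lemma bernoulli_le (R : realDomainType) (y : R) k :
  0 <= y <= 1 -> 1 - k%:R * y <= (1 - y) ^+ k.
Proof.
move=> /andP[y0 y1]; elim: k => [|k IH]; first by rewrite mul0r subr0 expr0.
rewrite exprS -natr1; have : (0 : R) <= k%:R := ler0n _ _.
set a := _ ^+ k in IH *; nra.
Qed.

Section localization.
Context {R : realType} {n : nat}.
Local Notation V := 'rV[R]_(n.+1 + n.+1).
Implicit Types (x w : V).

Lemma dotv_sphere x : sphere R n x -> dotv x x = 1.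
Proof.
by move=> sx; rewrite -[LHS]sqr_sqrtr ?dotv_ge0// [Num.sqrt _]sx expr1n.
Qed.

Lemma dotvD_sq x w : dotv (x + w) (x + w) = dotv x x + 2 * dotv w x + dotv w w.
Proof.
rewrite /dotv mulr_sumr -!big_split/=; apply: eq_bigr => i _.
by rewrite !mxE; ring.
Qed.

Lemma dotvB_sq x w : dotv (x - w) (x - w) = dotv x x - 2 * dotv w x + dotv w w.
Proof.
rewrite /dotv mulr_sumr -sumrB -!big_split/=; apply: eq_bigr => i _.
by rewrite !mxE; ring.
Qed.

Lemma dotv_sphere_ge x w : sphere R n x -> sphere R n w -> -1 <= dotv w x.
Proof.
move=> /dotv_sphere xx /dotv_sphere ww.
by have := dotv_ge0 (x + w); rewrite dotvD_sq xx ww; lra.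
Qed.

(** The support lies in a cube of side (l + 1) / k, and 1 - <w, x> is half the
    squared distance of the unit vectors x and w. *)
Lemma grid_bump_supp l k N (a : {ffun _ -> 'I_N}) x w :
  (0 < k)%N -> sphere R n x -> sphere R n w ->
  grid_bump l k a x != 0 -> grid_bump l k a w != 0 ->
  1 - dotv w x <= (n.+1 + n.+1)%:R * (l.+1%:R / k%:R) ^+ 2 / 2.
Proof.
move=> k0 /dotv_sphere xx /dotv_sphere ww ax aw.
suff : dotv (x - w) (x - w) <= (n.+1 + n.+1)%:R * (l.+1%:R / k%:R) ^+ 2.
  by rewrite dotvB_sq xx ww; lra.
have -> : (n.+1 + n.+1)%:R * (l.+1%:R / k%:R) ^+ 2 =
    \sum_(i < n.+1 + n.+1) (l.+1%:R / k%:R : R) ^+ 2.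
  by rewrite sumr_const card_ord mulr_natl.
apply: ler_sum => i _; rewrite -expr2 !mxE.
move: ax aw => /prodf_neq0/(_ i isT)/bump_supp + /prodf_neq0/(_ i isT)/bump_supp.
rewrite /grid_coord => /andP[x0 x1] /andP[w0 w1].
have kR : (0 : R) < k%:R by rewrite ltr0n.
have H : `|k%:R * (x 0 i - w 0 i)| <= l.+1%:R.
  by rewrite ler_norml; apply/andP; split; lra.
rewrite -[X in X <= _]real_normK ?num_real// ler_sqr ?nnegrE// ?divr_ge0//.
by rewrite ler_pdivlMr// mulrC -[k%:R]gtr0_norm// -normrM.
Qed.

(** The sum over all multi-indices of a product is the product of the
    one-dimensional sums.  The shift c allows for the shorter bumps of
    [bump_inner], which start one unit later. *)
Lemma sum_grid_bump l l' k N (c : R) x : (k + k + l' <= N)%N ->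
  (forall i, l%:R <= grid_coord l' k x i - c <= N%:R) ->
  \sum_(a : {ffun 'I_(n.+1 + n.+1) -> 'I_N})
    \prod_i bump l (grid_coord l' k x i - (a i)%:R - c) =
  l%:R ^+ (n.+1 + n.+1).
Proof.
move=> kN xc; rewrite -(bigA_distr_bigA (fun i (j : 'I_N) =>
  bump l (grid_coord l' k x i - j%:R - c))) -[X in _ = _ ^+ X]card_ord -prodr_const.
apply: eq_bigr => i _; rewrite -[RHS](@sum_bump _ l N (grid_coord l' k x i - c)).
- by apply: eq_bigr => j _; congr bump; ring.
- by have /andP[] := xc i.
- by have /andP[] := xc i.
Qed.

(** The cutoffs are the [grid_bump]s of length l + 2 in the stretched
    coordinates.  A large l makes the transition layers negligible: the ratio of
    the lower to the upper bound is (l / (l + 2))^m.  A large k, chosen after l,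
    makes the cubes small. *)
Lemma localizing_family (p kap : R) : 0 < kap < 1 ->
  exists (I : finType) (F : I -> V -> R) (Lam : R),
  [/\ 0 < Lam,
      forall a, C1_sphere (F a) /\ measurable_fun setT (homog_ext (F a)),
      forall a x, 0 <= F a x <= 1,
      forall x, sphere R n x -> \sum_a F a x ^+ 2 <= Lam /\
        (1 - kap) * Lam <= \sum_a F a x `^ p &
      0 < p -> forall a, exists w, forall x, sphere R n x ->
        (2 - kap) * F a x `^ p <= 1 + dotv w x].
Proof.
move=> /andP[kap0 kap1]; set m := (n.+1 + n.+1)%N.
(* l + 2 >= 2 m / kap makes Bernoulli's bound at least 1 - kap *)
pose l := Num.truncn (2 * m%:R / kap).
have hl : 2 * m%:R / kap <= l.+2%:R.
  by rewrite ltW// (lt_trans (truncnS_gt _))// ltr_nat.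
(* the diameter bound of [grid_bump_supp] is at most kap as k <= k^2 *)
pose k := (Num.truncn (m%:R * l.+3%:R ^+ 2 / (2 * kap))).+1.
have hk : m%:R * l.+3%:R ^+ 2 / (2 * kap) <= k%:R.
  by rewrite ltW// truncnS_gt.
have k1 : (1 : R) <= k%:R by rewrite ler1n.
pose N := (k + k + l.+2)%N.
pose F (a : {ffun 'I_m -> 'I_N}) := @grid_bump R n l.+2 k N a.
exists _, F, (l.+2%:R ^+ m); split.
- by rewrite exprn_gt0.
- by move=> a; split; [exact: C1_sphere_grid_bump|exact: measurable_homog_grid_bump].
- by move=> a x; exact: grid_bump_itv.
- move=> x sx; split.
    rewrite -(@sum_grid_bump l.+2 l.+2 k N 0 x)//; last first.
      by move=> i; rewrite subr0; exact: grid_coord_itv.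
    apply: ler_sum => a _; under [X in _ <= X]eq_bigr do rewrite subr0.
    have /andP[? ?] := grid_bump_itv l.+2 k a x.
    by rewrite expr2 ler_piMl.
  apply: (@le_trans _ _ (l%:R ^+ m)).
    have l2 : (0 : R) < l.+2%:R by [].
    have y01 : 0 <= (2 : R) / l.+2%:R <= 1.
      by apply/andP; split; [exact: divr_ge0|rewrite ler_pdivrMr// mul1r (ler_nat _ 2)].
    have := bernoulli_le m y01.
    have -> : 1 - 2 / l.+2%:R = l%:R / l.+2%:R :> R.
      by rewrite -[l.+2]addn2 natrD; field; rewrite -natrD pnatr_eq0 addn2.
    rewrite expr_div_n ler_pdivlMr ?exprn_gt0// => H.
    apply: le_trans H; rewrite ler_pM2r ?exprn_gt0//.
    rewrite lerD2l lerN2 mulrA ler_pdivrMr//.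
    by move: hl; rewrite ler_pdivrMr// [_ * 2]mulrC [kap * _]mulrC.
  rewrite -(@sum_grid_bump l l.+2 k N 1 x)//; last first.
    move=> i; have /andP[] := grid_coord_itv l.+2 k i sx.
    by rewrite -/N -[l.+2%:R]natr1 -[l.+1%:R]natr1 => ? ?; apply/andP; split; lra.
  apply: ler_sum => a _.
  have [/eqP|] := boolP ((\prod_i bump l (grid_coord l.+2 k x i - (a i)%:R - 1)) == 0).
    by move=> ->; exact: powR_ge0.
  move=> /prodf_neq0 H; rewrite [F a x](_ : _ = 1).
    rewrite powR1.
    apply: le_trans (_ : \prod_(i < m) (1 : R) <= 1); last by rewrite big1.
    by apply: ler_prod => i _; exact: bump_itv.
  by apply: big1 => i _; apply: bump_inner; exact: H.
- move=> p0 a.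
  have [[w [sw aw]]|aw] := pselect (exists w, sphere R n w /\ F a w != 0).
    exists w => x sx; have [ax|ax] := eqVneq (F a x) 0.
      rewrite ax powR0 ?gt_eqF// mulr0.
      by have := dotv_sphere_ge sx sw; lra.
    have /andP[F0 F1] := grid_bump_itv l.+2 k a x.
    have Fp : F a x `^ p <= 1.
      have : F a x `^ p <= 1 `^ p by rewrite ge0_ler_powR// ?nnegrE// ltW.
      by rewrite powR1.
    have := grid_bump_supp (ltn0Sn _ : (0 < k)%N) sx sw ax aw.
    suff : m%:R * (l.+3%:R / k%:R) ^+ 2 / 2 <= kap.
      have := powR_ge0 (F a x) p; rewrite -/m; nra.
    rewrite expr_div_n mulrA ler_pdivrMr// ler_pdivrMr ?exprn_gt0 ?ltr0n//.
    move: hk; rewrite ler_pdivrMr ?mulr_gt0//; set M := m%:R * _ => H.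
    apply: (le_trans H); rewrite -subr_ge0.
    rewrite (_ : _ - _ = 2 * kap * (k%:R * (k%:R - 1))); last by ring.
    by rewrite !mulr_ge0 ?subr_ge0 ?ler0n// ltW.
  (* the cube misses the sphere: F a vanishes there, any w will do *)
  exists 0 => x sx; rewrite (_ : F a x = 0).
    rewrite powR0 ?gt_eqF// mulr0 /dotv big1 ?addr0// => i _.
    by rewrite mxE mul0r.
  by apply/eqP; apply: contrapT => /negP ax; apply: aw; exists x.
Qed.

End localization.

(** * Subgradients on the sphere *)

Section ge0_le_integral_scale.
Import HBNNSimple.

(** The integral of a nonnegative function is a supremum over the simple
    functions below it, and those can be scaled; so the comparison holds for
    arbitrary functions, in particular for integrands built from an unspecified
    function of class C^1 on the sphere. *)
Lemma ge0_le_integral_scale d (T : measurableType d) (R : realType)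
    (mu : {measure set T -> \bar R}) (D : set T) (f g : T -> R) (C : R) : 0 < C ->
  (forall x, D x -> 0 <= f x) -> (forall x, D x -> f x <= C * g x) ->
  (\int[mu]_(x in D) (f x)%:E <= C%:E * \int[mu]_(x in D) (g x)%:E)%E.
Proof.
move=> C0 f0 fg; have g0 x : D x -> 0 <= g x.
  by move=> Dx; rewrite -(pmulr_rge0 _ C0) (le_trans (f0 _ Dx))// fg.
rewrite integral_mkcond [X in (_ <= _ * X)%E]integral_mkcond.
have fD x : (0 <= ((fun x => (f x)%:E) \_ D) x)%E.
  by apply: erestrict_ge0 => t Dt; rewrite lee_fin f0.
have gD x : (0 <= ((fun x => (g x)%:E) \_ D) x)%E.
  by apply: erestrict_ge0 => t Dt; rewrite lee_fin g0.
rewrite ge0_integralTE// ge0_integralTE//.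
apply: ge_ereal_sup => _ [h/= hf <-].
have iC : 0 <= C^-1 by rewrite invr_ge0 ltW.
apply: (@le_trans _ _ (C%:E * sintegral mu (scale_nnsfun h iC))%E).
  rewrite -sintegralrM le_eqVlt; apply/orP; left; apply/eqP.
  by apply: eq_sintegral => x /=; rewrite mulVKf// gt_eqF.
rewrite lee_pmul2l//; apply: ereal_sup_ubound; exists (scale_nnsfun h iC) => //= x.
move: (hf x); rewrite /patch; case: ifPn => [/set_mem Dx|_].
  rewrite !lee_fin /= => hx; rewrite ler_pdivrMl//.
  exact: le_trans hx (fg _ Dx).
by rewrite !lee_fin /= => hx; exact: mulr_ge0_le0.
Qed.

End ge0_le_integral_scale.

Section sphere_calculus.
Context {R : realType} {n : nat}.
Local Notation V := 'rV[R]_(n.+1 + n.+1).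
Implicit Types (x v w : V) (phi eta : V -> R).

Lemma measurable_sphere : measurable (sphere R n).
Proof.
have := @measurable_normv R (n.+1 + n.+1) measurableT _ (measurable_set1 1).
by rewrite setTI.
Qed.

Lemma sphere_neq0 x : sphere R n x -> x != 0.
Proof.
move=> /dotv_sphere xx; apply/eqP => x0; move: xx.
rewrite x0 /dotv big1 => [/eqP|i _]; last by rewrite mxE mul0r.
by rewrite eq_sym oner_eq0.
Qed.

Lemma homog_ext_sphere phi x : sphere R n x -> homog_ext phi x = phi x.
Proof. by move=> sx; rewrite /homog_ext [normv x]sx invr1 scale1r. Qed.

Lemma C1_sphereM phi eta : C1_sphere phi -> C1_sphere eta -> C1_sphere (phi * eta).
Proof. exact: C1_away0M. Qed.

Lemma horizontal_projD x v w :
  horizontal_proj x (v + w) = horizontal_proj x v + horizontal_proj x w.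
Proof.
have D : theta0 x (v + w) = theta0 x v + theta0 x w.
  rewrite !theta0_mul_i -mulrDr; congr (2 * _).
  by rewrite /dotv -big_split/=; apply: eq_bigr => i _; rewrite [(v + w) 0 i]mxE mulrDr.
by apply/rowP => i; rewrite /horizontal_proj D !mxE; ring.
Qed.

Lemma horizontal_projZ x (c : R) v :
  horizontal_proj x (c *: v) = c *: horizontal_proj x v.
Proof.
have D : theta0 x (c *: v) = c * theta0 x v.
  rewrite !theta0_mul_i mulrCA; congr (2 * _).
  by rewrite /dotv mulr_sumr; apply: eq_bigr => i _; rewrite [(c *: v) 0 i]mxE mulrCA.
by apply/rowP => i; rewrite /horizontal_proj D !mxE; ring.
Qed.

Lemma subgradientM phi eta x : C1_sphere phi -> C1_sphere eta -> sphere R n x ->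
  subgradient (phi * eta) x = phi x *: subgradient eta x + eta x *: subgradient phi x.
Proof.
move=> cphi ceta sx; have x0 := sphere_neq0 sx.
have -> : subgradient (phi * eta) x = 4^-1 *: horizontal_proj x
    (phi x *: round_gradient eta x + eta x *: round_gradient phi x).
  congr (_ *: horizontal_proj _ _); apply/rowP => i; rewrite !mxE.
  have [[df _] [dg _]] := (cphi _ x0, ceta _ x0).
  rewrite (_ : homog_ext (phi * eta) = homog_ext phi * homog_ext eta)//.
  by rewrite deriveM ?homog_ext_sphere//; exact: diff_derivable.
have E (c p q : R) (a b : V) :
    c *: (p *: a + q *: b) = p *: (c *: a) + q *: (c *: b).
  by rewrite scalerDr !scalerA ![c * _]mulrC.
by rewrite horizontal_projD !horizontal_projZ E.
Qed.

Lemma levi_ge0 x v : 0 <= levi x v v.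
Proof. by rewrite leviE mulr_ge0// dotv_ge0. Qed.

Lemma leviZ x (c : R) v : levi x (c *: v) (c *: v) = c ^+ 2 * levi x v v.
Proof.
rewrite !leviE mulrCA; congr (4 * _); rewrite /dotv mulr_sumr.
by apply: eq_bigr => i _; rewrite !mxE; ring.
Qed.

Lemma levi_young x (c : R) v w : 0 < c ->
  levi x (v + w) (v + w) <= (1 + c) * levi x v v + (1 + c^-1) * levi x w w.
Proof.
move=> c0; rewrite !leviE !mulrA ![_ * 4]mulrC -!mulrA -mulrDr ler_pM2l//.
rewrite /dotv !mulr_sumr -big_split/=; apply: ler_sum => i _; rewrite !mxE.
set a := v 0 i; set b := w 0 i; rewrite -subr_ge0.
have -> : (1 + c) * (a * a) + (1 + c^-1) * (b * b) - (a + b) * (a + b) =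
    c^-1 * (c * a - b) ^+ 2 by field; rewrite gt_eqF.
by rewrite mulr_ge0 ?sqr_ge0// invr_ge0 ltW.
Qed.

Lemma measurable_rV_in (D : set V) (g : V -> V) : measurable D ->
  (forall i, measurable_fun D (fun x => g x 0 i)) -> measurable_fun D g.
Proof.
move=> mD mg; pose h x : V := \row_i ((fun x => g x 0 i) \_ D) x.
apply: (@eq_measurable_fun _ _ _ _ D h).
  by move=> x xD; apply/rowP => i; rewrite mxE /patch xD.
apply: measurable_funTS; apply: measurable_rVP => i.
under eq_fun do rewrite mxE.
exact: ((measurable_restrictT (fun x => g x 0 i) mD).1 (mg i)).
Qed.

Lemma measurable_fun_dotv d (T : measurableType d) (D : set T) (g h : T -> V) :
  measurable_fun D g -> measurable_fun D h ->
  measurable_fun D (fun t => dotv (g t) (h t)).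
Proof.
move=> mg mh; apply: measurable_sum => i; apply: measurable_funM.
  exact: (measurableT_comp (measurable_rV_coord i) mg).
exact: (measurableT_comp (measurable_rV_coord i) mh).
Qed.

Lemma measurable_fun_levi d (T : measurableType d) (D : set T) (p g h : T -> V) :
  measurable_fun D g -> measurable_fun D h ->
  measurable_fun D (fun t => levi (p t) (g t) (h t)).
Proof.
move=> mg mh; under eq_fun do rewrite leviE.
by apply: measurable_funM => //; exact: measurable_fun_dotv.
Qed.

Lemma measurable_mul_i : measurable_fun setT (@mul_i R n).
Proof.
apply: measurable_rVP => i; case: (split_ordP i) => j ->.
  under eq_fun do rewrite row_mxEl !mxE.
  by apply: measurable_funN; exact: measurable_rV_coord.
under eq_fun do rewrite row_mxEr !mxE.
exact: measurable_rV_coord.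
Qed.

Lemma dotv_mul_i x : dotv (mul_i x) (mul_i x) = dotv x x.
Proof.
rewrite /dotv !big_split_ord/= addrC; congr (_ + _).
  by apply: eq_bigr => i _; rewrite !row_mxEr !mxE.
by apply: eq_bigr => i _; rewrite !row_mxEl !mxE; ring.
Qed.

(** On the unit sphere mul_i x is a unit vector, so that the projection becomes a
    polynomial expression, whence measurability. *)
Lemma horizontal_proj_sphere x v : sphere R n x ->
  horizontal_proj x v = v - dotv (mul_i x) v *: mul_i x.
Proof.
move=> /dotv_sphere xx; rewrite /horizontal_proj !theta0_mul_i dotv_mul_i xx.
by rewrite mulr1 mulrC mulKf.
Qed.

Lemma measurable_subgradient eta : C1_sphere eta ->
  measurable_fun setT (homog_ext eta) ->
  measurable_fun (sphere R n) (subgradient eta).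
Proof.
move=> ceta meta; have mS := measurable_sphere.
have mg : measurable_fun (sphere R n) (round_gradient eta).
  apply: measurable_rV_in => // i; under eq_fun do rewrite mxE.
  apply: measurable_derive => // x /sphere_neq0 x0.
  by apply: diff_derivable; case: (ceta x x0).
apply: (@eq_measurable_fun _ _ _ _ _ (fun x => 4^-1 *: (round_gradient eta x -
    dotv (mul_i x) (round_gradient eta x) *: mul_i x))).
  by move=> x /set_mem sx; rewrite /subgradient horizontal_proj_sphere.
have mi := measurable_funTS measurable_mul_i : measurable_fun (sphere R n) _.
apply: measurable_rV_in => // i.
have mgi := measurableT_comp (measurable_rV_coord i) mg.
have mii := measurableT_comp (measurable_rV_coord i) mi.
rewrite (_ : (fun x => _) = (fun x => 4^-1 * (round_gradient eta x 0 i -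
    dotv (mul_i x) (round_gradient eta x) * mul_i x 0 i))); last first.
  by apply/funext => x; rewrite mxE; congr (_ * _); rewrite mxE; congr (_ + _);
    rewrite mxE; congr (- _); rewrite mxE.
apply: measurable_funM => //; apply: measurable_funB => //.
by apply: measurable_funM => //; exact: measurable_fun_dotv.
Qed.

Lemma closed_sphere : closed (sphere R n).
Proof.
have -> : sphere R n = (fun x => dotv x x) @^-1` [set 1].
  apply/seteqP; split=> x /= [] sx; first exact: dotv_sphere.
  by rewrite /sphere/= /normv sx sqrtr1.
apply: closed_comp; last exact: closed_eq.
move=> x _; apply: differentiable_continuous.
rewrite (_ : (fun x => _) = \sum_i (fun x : V => x 0 i) * (fun x : V => x 0 i)).
  by apply: differentiable_sum => i; apply: differentiableM;
    exact: differentiable_coord.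
by apply/funext => y; rewrite fct_sumE.
Qed.

Lemma compact_sphere : compact (sphere R n).
Proof.
apply: bounded_closed_compact closed_sphere.
exists 1; split => // M M1 x sx; apply: le_trans (ltW M1).
have -> : `|x| = mx_norm x by [].
have [->//|/mx_norm_neq0[[i j]/= ij]] := eqVneq (mx_norm x) 0.
rewrite ij (ord1 i).
by have := sphere_coord_itv j sx; rewrite -ler_norml.
Qed.

(** The round gradient is continuous on the compact sphere, and the horizontal
    projection does not increase lengths. *)
Lemma subgradient_bounded eta : C1_sphere eta ->
  exists2 B, 0 < B & forall x, sphere R n x ->
    levi x (subgradient eta x) (subgradient eta x) <= B.
Proof.
move=> ceta.
have /choice[b hb] : forall i, exists b : R, forall x, sphere R n x ->
    `|round_gradient eta x 0 i| <= b.
  move=> i; have cD : {within sphere R n, continuous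
      (fun x => 'D_(delta_mx 0 i) (homog_ext eta) x)}.
    apply: continuous_in_subspaceT => x /set_mem /sphere_neq0 x0.
    by have [_] := ceta x x0; exact.
  have /compact_bounded[M [_ HM]] := continuous_compact cD compact_sphere.
  exists (`|M| + 1) => x sx; rewrite mxE; apply: HM; last by exists x.
  by rewrite (le_lt_trans (ler_norm M))// ltrDl.
exists (1 + \sum_i b i ^+ 2); first by rewrite ltr_pwDl// sumr_ge0// => i _; rewrite sqr_ge0.
move=> x sx; set v := round_gradient eta x.
have vb : dotv v v <= \sum_i b i ^+ 2.
  apply: ler_sum => i _; rewrite -expr2 -[X in X <= _]real_normK ?num_real//.
  have vi := hb i x sx; rewrite ler_sqr ?nnegrE//; exact: le_trans vi.
have E : dotv (horizontal_proj x v) (horizontal_proj x v) =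
    dotv v v - dotv (mul_i x) v ^+ 2.
  rewrite horizontal_proj_sphere// dotvB_sq; set c := dotv (mul_i x) v.
  have lZ (a e : V) d : dotv (d *: a) e = d * dotv a e.
    by rewrite /dotv mulr_sumr; apply: eq_bigr => i _; rewrite mxE mulrA.
  have -> : dotv (c *: mul_i x) (c *: mul_i x) = c ^+ 2.
    have dC (a e : V) : dotv a e = dotv e a.
      by apply: eq_bigr => i _; exact: mulrC.
    by rewrite lZ dC lZ dotv_mul_i dotv_sphere// mulr1 expr2.
  by rewrite lZ -/c; ring.
rewrite /subgradient leviZ leviE E.
have := sqr_ge0 (dotv (mul_i x) v); have := dotv_ge0 v; lra.
Qed.

End sphere_calculus.

(** * Cutoffs of Folland-Stein functions and the Yamabe inequality *)

Section folland_stein_facts.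
Context {R : realType} {n : nat}.
Local Notation V := 'rV[R]_(n.+1 + n.+1).
Local Notation mu := (dV R n).
Local Notation S := (sphere R n).
Local Notation p := (crit_exp R n).
Local Notation theta := (n%:R / n.+1%:R : R).
Local Notation curv := (@webster_curvature R n).
Implicit Types (x : V) (eta : V -> R) (u : folland_stein R n).

Lemma measurable_C1_sphere eta : measurable_fun setT (homog_ext eta) ->
  measurable_fun S eta.
Proof.
move=> meta; apply: (@eq_measurable_fun _ _ _ _ _ (homog_ext eta)).
  by move=> x /set_mem; exact: homog_ext_sphere.
exact: measurable_funTS.
Qed.

Section cutoff.
Variables (u : folland_stein R n) (eta : V -> R).
Hypotheses (ceta : C1_sphere eta) (meta : measurable_fun setT (homog_ext eta)).
Hypothesis eta01 : forall x, 0 <= eta x <= 1.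

Definition cutoff_fun x := eta x * u x.

Definition cutoff_grad x := eta x *: fs_grad u x + u x *: subgradient eta x.

Lemma measurable_cutoff_fun : measurable_fun S cutoff_fun.
Proof.
apply: measurable_funM; last exact: fs_measurable.
exact: measurable_C1_sphere.
Qed.

Lemma measurable_cutoff_grad : measurable_fun S cutoff_grad.
Proof.
have mc := measurable_rV_coord.
apply: measurable_rV_in => [|i]; first exact: measurable_sphere.
have m1 := measurableT_comp (mc _ _ i) (fs_grad_measurable u).
have m2 := measurableT_comp (mc _ _ i) (measurable_subgradient ceta meta).
rewrite (_ : (fun x => _) = (fun x => eta x * fs_grad u x 0 i +
    u x * subgradient eta x 0 i)); last first.
  apply/funext => x; rewrite mxE; congr (_ + _); rewrite mxE//.
apply: measurable_funD; apply: measurable_funM => //.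
  exact: measurable_C1_sphere.
exact: fs_measurable.
Qed.

(** If phi_k approximates u then eta phi_k approximates eta u, as multiplication
    by eta is bounded in the Folland-Stein norm. *)
Lemma cutoff_closure : exists phi : nat -> V -> R,
  (forall k, C1_sphere (phi k)) /\
  (\int[mu]_(x in S)
    (levi x (cutoff_grad x - subgradient (phi k) x)
            (cutoff_grad x - subgradient (phi k) x)
     + (cutoff_fun x - phi k x) ^+ 2)%:E @[k --> \oo] --> 0)%E.
Proof.
have [phi [cphi phiu]] := fs_closure u.
have [B B0 hB] := subgradient_bounded ceta.
exists (fun k => phi k * eta); split=> [k|]; first exact: C1_sphereM.
(* 2 for each half of Young's inequality, 1 for the function itself *)
pose C := 3 + 2 * B; have C0 : 0 < C by rewrite /C; lra.
have := cvgeZl (_ : C%:E \is a fin_num) phiu; rewrite mule0 => /(_ isT) HC.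
apply: squeeze_cvge (cvg_cst 0%E) HC.
near=> k; rewrite integral_ge0/=; last first.
  by move=> x _; rewrite lee_fin addr_ge0 ?levi_ge0 ?sqr_ge0.
apply: ge0_le_integral_scale => // x sx.
  by rewrite addr_ge0 ?levi_ge0 ?sqr_ge0.
rewrite (subgradientM (cphi k) ceta sx).
set g := fs_grad u x; set h := subgradient (phi k) x.
set d := u x - phi k x.
have -> : cutoff_grad x - (phi k x *: subgradient eta x + eta x *: h) =
    eta x *: (g - h) + d *: subgradient eta x.
  have E (e r f : R) (G H T : V) :
      e *: G + r *: T - (f *: T + e *: H) = e *: (G - H) + (r - f) *: T.
    by apply/rowP => i; rewrite !mxE; ring.
  exact: E.
have -> : cutoff_fun x - (phi k * eta) x = eta x * d.
  by rewrite /cutoff_fun /d !fctE; ring.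
apply: (@le_trans _ _ (2 * levi x (eta x *: (g - h)) (eta x *: (g - h)) +
    2 * levi x (d *: subgradient eta x) (d *: subgradient eta x) +
    (eta x * d) ^+ 2)).
  rewrite lerD2r; have := levi_young x (eta x *: (g - h)) (d *: subgradient eta x)
    (ltr01 : 0 < (1 : R)).
  by rewrite invr1.
rewrite (leviZ x (eta x) (g - h)) (leviZ x d (subgradient eta x)).
have e2 : eta x ^+ 2 <= 1 by have /andP[? ?] := eta01 x; rewrite expr_le1.
have := hB x sx; have := levi_ge0 x (g - h); have := sqr_ge0 d.
rewrite exprMn; have := sqr_ge0 (eta x).
set e := eta x ^+ 2 in e2 *; set L := levi x (g - h) _.
set L' := levi x (subgradient eta x) _ => e0 d0 L0 LB.
have h1 : e * L <= L by rewrite ler_piMl.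
have h2 : e * d ^+ 2 <= d ^+ 2 by rewrite ler_piMl.
have h3 : d ^+ 2 * L' <= d ^+ 2 * B by rewrite ler_wpM2l.
have h4 : 0 <= B * L by rewrite mulr_ge0 // ltW.
rewrite /C; lra.
Unshelve. all: by end_near. Qed.

Definition fs_cutoff : folland_stein R n :=
  FollandStein measurable_cutoff_fun measurable_cutoff_grad cutoff_closure.

End cutoff.

Lemma dirichlet_density_ge0 u x : 0 <= dirichlet_density u x.
Proof. exact: levi_ge0. Qed.

Lemma measurable_dirichlet_density u : measurable_fun S (dirichlet_density u).
Proof. by apply: measurable_fun_levi; exact: fs_grad_measurable. Qed.

Lemma integral_quadratic u (a b : R) : 0 <= a -> 0 <= b ->
  (\int[mu]_(x in S) (a * dirichlet_density u x + b * u x ^+ 2)%:E =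
   a%:E * \int[mu]_(x in S) (dirichlet_density u x)%:E +
   b%:E * \int[mu]_(x in S) (u x ^+ 2)%:E)%E.
Proof.
move=> a0 b0; have mS := @measurable_sphere R n.
have mD : measurable_fun S (fun x => (dirichlet_density u x)%:E).
  by apply/measurable_EFinP; exact: measurable_dirichlet_density.
have mu2 : measurable_fun S (fun x => (u x ^+ 2)%:E).
  by apply/measurable_EFinP; apply: measurable_funX; exact: fs_measurable.
have D0 x : S x -> (0 <= (dirichlet_density u x)%:E)%E.
  by rewrite lee_fin dirichlet_density_ge0.
have u0 x : S x -> (0 <= (u x ^+ 2)%:E)%E by rewrite lee_fin sqr_ge0.
rewrite -!ge0_integralZl_EFin// -ge0_integralD//.
- by move=> x sx; rewrite mule_ge0// D0.
- exact: measurable_funeM.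
- by move=> x sx; rewrite mule_ge0// u0.
- exact: measurable_funeM.
Qed.

Lemma measurable_powR_fs u : measurable_fun S (fun x => `|u x| `^ p).
Proof.
apply: (measurableT_comp (measurable_powR _)).
by apply: measurableT_comp => //; exact: fs_measurable.
Qed.

Lemma crit_exp_gt0 : 0 < p.
Proof. by rewrite ltr_pwDl// divr_ge0. Qed.

Lemma webster_curvature_ge0 : 0 <= curv.
Proof. by rewrite divr_ge0// mulr_ge0. Qed.

Lemma cr_yamabe_invariant_ge0 : (0 <= cr_yamabe_invariant R n)%E.
Proof.
apply: le_ereal_inf_tmp => _ [u _ <-]; apply: mule_ge0.
  apply: integral_ge0 => x _; rewrite lee_fin addr_ge0// mulr_ge0//.
  - exact: ltW crit_exp_gt0.
  - exact: dirichlet_density_ge0.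
  - exact: webster_curvature_ge0.
  - exact: sqr_ge0.
by rewrite inve_ge0 poweR_ge0.
Qed.

(** This is the definition of the infimum, except when the integral of |u|^p
    is 0 or infinite.  In the latter case the quotient of u is 0, hence the
    invariant vanishes and the inequality still holds. *)
Lemma yamabe_le u : (0 < n)%N ->
  (cr_yamabe_invariant R n *
     (\int[mu]_(x in S) (`|u x| `^ p)%:E) `^ theta <=
   \int[mu]_(x in S)
     (p * dirichlet_density u x + curv * u x ^+ 2)%:E)%E.
Proof.
move=> n0; set D := (\int[mu]_(x in S) _)%E; set N := (\int[mu]_(x in S) _)%E.
have N0 : (0 <= N)%E.
  apply: integral_ge0 => x _; rewrite lee_fin addr_ge0// mulr_ge0//.
  - exact: ltW crit_exp_gt0.
  - exact: dirichlet_density_ge0.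
  - exact: webster_curvature_ge0.
  - exact: sqr_ge0.
have D0 : (0 <= D)%E by apply: integral_ge0 => x _; rewrite lee_fin powR_ge0.
have th0 : theta != 0 by rewrite mulf_neq0 ?invr_eq0 ?pnatr_eq0 -?lt0n.
have [DE|Dn0] := eqVneq D 0%E; first by rewrite DE poweR0r// mule0.
have YN : (cr_yamabe_invariant R n <= N / D `^ theta)%E.
  apply: ereal_inf_lbound; exists u => //= u0; move/eqP: Dn0; apply.
  rewrite /D (ae_eq_integral (cst 0%E)) ?integral0//.
  - exact: measurable_sphere.
  - by apply/measurable_EFinP; exact: measurable_powR_fs.
  - apply: filterS u0 => x ux _ /=.
    by rewrite ux normr0 powR0// gt_eqF// crit_exp_gt0.
have [Dy|Dy] := eqVneq D +oo%E.
  move: YN; rewrite Dy poweRyr// invey mule0 => Y0.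
  suff -> : cr_yamabe_invariant R n = 0%E by rewrite mul0e.
  by apply/eqP; rewrite eq_le Y0 cr_yamabe_invariant_ge0.
have Dfin : D \is a fin_num by rewrite ge0_fin_numE// ltey.
have Dpos : 0 < fine D `^ theta.
  by rewrite powR_gt0// fine_gt0// lt_neqAle eq_sym Dn0 D0 ltey Dy.
by move: YN; rewrite -(fineK Dfin) poweR_EFin inver gt_eqF//= lee_pdivlMr.
Qed.

End folland_stein_facts.

(** * Balanced functions *)

(** Concavity: the graph of m^theta lies above its chord on [0, t]. *)
Lemma le_sum_powR (R : realType) (I : finType) (m : I -> R) (t theta : R) :
  0 < t -> 0 < theta <= 1 -> (forall a, 0 <= m a <= t) ->
  t `^ theta / t * \sum_a m a <= \sum_a m a `^ theta.
Proof.
move=> t0 /andP[th0 th1] mt; rewrite mulr_sumr; apply: ler_sum => a _.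
have /andP[] := mt a; rewrite le_eqVlt => /predU1P[<- _|m0 mat].
  by rewrite mulr0 powR_ge0.
have -> : m a `^ theta = t `^ theta * (m a / t) `^ theta.
  by rewrite -powRM ?divr_ge0 ?(ltW m0) ?(ltW t0)// mulrC divfK ?gt_eqF.
rewrite -mulrA ler_wpM2l ?powR_ge0// mulrC ger1_powR//.
by rewrite divr_gt0// ler_pdivrMr// mul1r.
Qed.

(** With s = 1/(n+1), the limit of the constant as kap tends to 0 is 2^(-s) p; the
    condition on kap makes the error at most eps.  The factor 8 leaves room for
    (1 + kap) <= (1 - kap/2) (1 - kap) (1 + 8 kap), true for kap <= 1/4. *)
Lemma localized_constant_le (R : realType) (s p kap eps : R) : 0 < s <= 1 ->
  0 < p -> 0 < kap <= 4^-1 -> 8 * kap * (2 `^ (- s) * p) <= eps ->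
  p * (1 + kap) <=
    (2 - kap) / (2 - kap) `^ (1 - s) * (1 - kap) * (2 `^ (- s) * p + eps).
Proof.
move=> /andP[s0 s1] p0 /andP[k0 k4] ke; have t0 : 0 < 2 - kap by lra.
have -> : (2 - kap) / (2 - kap) `^ (1 - s) = (2 - kap) `^ s.
  rewrite -{1}(powRr1 (ltW t0)) -powRB; first by congr (_ `^ _); ring.
  by apply/implyP => _; rewrite gt_eqF.
have h1 : 2 `^ s * (1 - kap / 2) <= (2 - kap) `^ s.
  have -> : 2 - kap = 2 * (1 - kap / 2) by field.
  rewrite powRM ?ler_wpM2l ?powR_ge0//; last by lra.
  by rewrite ger1_powR//; apply/andP; split; lra.
have h2 : 2 `^ (- s) * p * (1 + 8 * kap) <= 2 `^ (- s) * p + eps by lra.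
have q0 : 0 < 2 `^ s :> R by rewrite powR_gt0.
apply: (@le_trans _ _ (2 `^ s * (1 - kap / 2) * (1 - kap) *
    (2 `^ (- s) * p * (1 + 8 * kap)))); last first.
  have c0 : 0 <= 2 `^ (- s) * p * (1 + 8 * kap).
    by rewrite !mulr_ge0 ?powR_ge0//; lra.
  apply: ler_pM => //.
  - by rewrite !mulr_ge0 ?powR_ge0//; lra.
  - by rewrite ler_wpM2r//; lra.
rewrite powRN [X in _ <= X](_ : _ = p * ((1 - kap / 2) * (1 - kap) * (1 + 8 * kap))).
  rewrite ler_pM2l//.
  have : 0 <= kap * (11 - 23 * kap) by rewrite mulr_ge0 ?ltW//; lra.
  have : 0 <= kap ^+ 3 by rewrite exprn_ge0// ltW.
  by rewrite !exprS expr0; lra.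
by field; rewrite gt_eqF.
Qed.

Section balanced.
Context {R : realType} {n : nat}.
Local Notation V := 'rV[R]_(n.+1 + n.+1).
Local Notation mu := (dV R n).
Local Notation S := (sphere R n).
Local Notation p := (crit_exp R n).
Implicit Types (x w : V).
Variable u : folland_stein R n.
Hypothesis u_ge0 : {ae mu, forall x, 0 <= u x}.

Lemma measurable_powR_fs_id : measurable_fun S (fun x => u x `^ p).
Proof.
by apply: (measurableT_comp (measurable_powR _)); exact: fs_measurable.
Qed.

Lemma integral_powR_norm (f : V -> R) : measurable_fun S f ->
  (\int[mu]_(x in S) (f x * u x `^ p)%:E =
   \int[mu]_(x in S) (f x * `|u x| `^ p)%:E)%E.
Proof.
move=> mf; apply: ae_eq_integral.
- exact: measurable_sphere.
- apply/measurable_EFinP; apply: measurable_funM => //.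
  exact: measurable_powR_fs_id.
- apply/measurable_EFinP; apply: measurable_funM => //; exact: measurable_powR_fs.
- by apply: filterS u_ge0 => x ux _; rewrite ger0_norm.
Qed.

Lemma integral_powR_norm1 :
  (\int[mu]_(x in S) (u x `^ p)%:E = \int[mu]_(x in S) (`|u x| `^ p)%:E)%E.
Proof.
have := @integral_powR_norm (cst 1) (@measurable_cst _ _ _ _ _ _).
by under eq_integral do rewrite mul1r; under [X in _ = X -> _]eq_integral do rewrite mul1r.
Qed.

Hypothesis fin_mass : (\int[mu]_(x in S) (`|u x| `^ p)%:E < +oo)%E.
Hypothesis balanced : forall i, \int[mu]_(x in S) (x 0 i * u x `^ p) = 0.

Lemma integrable_mass : mu.-integrable S (fun x => (`|u x| `^ p)%:E).
Proof.
apply/integrableP; split.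
  by apply/measurable_EFinP; exact: measurable_powR_fs.
apply: le_lt_trans fin_mass; rewrite le_eqVlt; apply/orP; left; apply/eqP.
by apply: eq_integral => x _; rewrite gee0_abs// lee_fin powR_ge0.
Qed.

Lemma integrable_coord i : mu.-integrable S (fun x => (x 0 i * `|u x| `^ p)%:E).
Proof.
apply: le_integrable integrable_mass; first exact: measurable_sphere.
  apply/measurable_EFinP; apply: measurable_funM; last exact: measurable_powR_fs.
  exact: measurable_funTS (measurable_rV_coord i).
move=> x sx; rewrite lee_fin normrM ler_piMl//.
by rewrite ler_norml; exact: sphere_coord_itv.
Qed.

Lemma integral_coord i : (\int[mu]_(x in S) (x 0 i * `|u x| `^ p)%:E = 0)%E.
Proof.
have mS := @measurable_sphere R n.
rewrite -(fineK (integrable_fin_num mS (integrable_coord i))).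
rewrite -integral_powR_norm; first by have := balanced i; rewrite /Rintegral => ->.
exact: measurable_funTS (measurable_rV_coord i).
Qed.

(** This is where the vanishing of the barycenter enters. *)
Lemma integral_dotv w :
  (\int[mu]_(x in S) ((1 + dotv w x) * `|u x| `^ p)%:E =
   \int[mu]_(x in S) (`|u x| `^ p)%:E)%E.
Proof.
have mS := @measurable_sphere R n.
have iw i : mu.-integrable S (fun x => (w 0 i)%:E * (x 0 i * `|u x| `^ p)%:E)%E.
  by apply: integrableZl => //; exact: integrable_coord.
transitivity (\int[mu]_(x in S) ((`|u x| `^ p)%:E +
    \sum_i (w 0 i)%:E * (x 0 i * `|u x| `^ p)%:E))%E.
  apply: eq_integral => x _; rewrite sumEFin -EFinD; congr EFin.
  rewrite mulrDl mul1r /dotv mulr_suml; congr (_ + _).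
  by apply: eq_bigr => i _; rewrite mulrA.
rewrite integralD//; last 2 first.
- exact: integrable_mass.
- exact: integrable_sum.
rewrite integral_sum// big1 ?adde0// => i _.
by rewrite integralZl ?integral_coord ?mule0//; exact: integrable_coord.
Qed.

Lemma localized_mass_le (f : V -> R) (c : R) w : 0 < c ->
  (forall x, 0 <= f x) -> (forall x, S x -> c * f x <= 1 + dotv w x) ->
  (c%:E * \int[mu]_(x in S) (f x * `|u x| `^ p)%:E <=
   \int[mu]_(x in S) (`|u x| `^ p)%:E)%E.
Proof.
move=> c0 f0 fw; rewrite -lee_pdivlMl// -(integral_dotv w).
apply: ge0_le_integral_scale; first by rewrite invr_gt0.
  by move=> x _; rewrite mulr_ge0// powR_ge0.
move=> x sx; rewrite ler_pdivlMl// mulrA ler_wpM2r ?powR_ge0//.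
exact: fw.
Qed.

End balanced.

(** * Summing the Yamabe inequality over the localizing family *)

Section localized_yamabe.
Context {R : realType} {n : nat}.
Local Notation V := 'rV[R]_(n.+1 + n.+1).
Local Notation mu := (dV R n).
Local Notation S := (sphere R n).
Local Notation p := (crit_exp R n).
Local Notation theta := (n%:R / n.+1%:R : R).
Local Notation curv := (@webster_curvature R n).
Implicit Types (x w : V).

Variables (I : finType) (F : I -> V -> R) (Lam kap B : R).
Hypotheses (n0 : (0 < n)%N) (Lam0 : 0 < Lam) (kap0 : 0 < kap) (kap1 : kap < 1).
Hypothesis cF : forall a, C1_sphere (F a).
Hypothesis mF : forall a, measurable_fun setT (homog_ext (F a)).
Hypothesis F01 : forall a x, 0 <= F a x <= 1.
Hypothesis F2 : forall x, S x -> \sum_a F a x ^+ 2 <= Lam.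
Hypothesis Fp : forall x, S x -> (1 - kap) * Lam <= \sum_a F a x `^ p.
Hypothesis Fw : forall a, exists w, forall x, S x ->
  (2 - kap) * F a x `^ p <= 1 + dotv w x.
Hypothesis FB : forall x, S x ->
  \sum_a levi x (subgradient (F a) x) (subgradient (F a) x) <= B.

Let k20 : 0 < 2 - kap.
Proof. by rewrite subr_gt0 (lt_trans kap1)// ltr1n. Qed.

Let wF (u : folland_stein R n) a := fs_cutoff u (cF a) (mF a) (F01 a).

(** Young's inequality splits grad (F_a u) = F_a grad u + u grad F_a at the cost of
    a factor 1 + kap on the first part; then the bound on the sum of the F_a^2
    applies. *)
Lemma sum_energy_le (u : folland_stein R n) (al be : R) : 0 < al -> 0 < be ->
  p * (1 + kap) * Lam <= al ->
  p * (1 + kap^-1) * B + curv * Lam <= be ->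
  (\sum_a \int[mu]_(x in S)
     (p * dirichlet_density (wF u a) x + curv * wF u a x ^+ 2)%:E
   <= \int[mu]_(x in S) (al * dirichlet_density u x + be * u x ^+ 2)%:E)%E.
Proof.
move=> al0 be0 hal hbe; have p0 := @crit_exp_gt0 R n.
have W0 := @webster_curvature_ge0 R n.
rewrite -ge0_integral_sum//; last 3 first.
- exact: measurable_sphere.
- move=> a; apply/measurable_EFinP; apply: measurable_funD; apply: measurable_funM => //.
    exact: measurable_dirichlet_density.
  by apply: measurable_funX; exact: fs_measurable.
- move=> a x _; rewrite lee_fin addr_ge0// mulr_ge0 ?(ltW p0)//.
    exact: dirichlet_density_ge0.
  exact: sqr_ge0.
under eq_integral do rewrite sumEFin.
rewrite -[X in (_ <= X)%E]mul1e; apply: ge0_le_integral_scale => // x sx.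
  apply: sumr_ge0 => a _; rewrite addr_ge0// mulr_ge0 ?(ltW p0)//.
    exact: dirichlet_density_ge0.
  exact: sqr_ge0.
rewrite mul1r.
set L := dirichlet_density u x; have L0 : 0 <= L := dirichlet_density_ge0 u x.
pose b a := levi x (subgradient (F a) x) (subgradient (F a) x).
have Ea a : p * dirichlet_density (wF u a) x + curv * wF u a x ^+ 2
    <= F a x ^+ 2 * (p * (1 + kap) * L + curv * u x ^+ 2) +
       b a * (p * (1 + kap^-1) * u x ^+ 2).
  have -> : wF u a x = F a x * u x by [].
  have : dirichlet_density (wF u a) x <=
      (1 + kap) * (F a x ^+ 2 * L) + (1 + kap^-1) * (u x ^+ 2 * b a).
    rewrite /b /L /dirichlet_density -(leviZ x (F a x) (fs_grad u x)).
    rewrite -(leviZ x (u x) (subgradient (F a) x)).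
    exact: levi_young.
  move=> /(ler_wpM2l (ltW p0)) h; rewrite exprMn; apply: le_trans (lerD h (lexx _)) _.
  by rewrite le_eqVlt; apply/orP; left; apply/eqP; ring.
apply: le_trans (ler_sum _ (fun a _ => Ea a)) _.
rewrite big_split/= -!mulr_suml.
have u2 := sqr_ge0 (u x).
have p0' := ltW p0; have k1 : 0 <= 1 + kap by rewrite addr_ge0// ltW.
have k2 : 0 <= 1 + kap^-1 by rewrite addr_ge0// invr_ge0 ltW.
have h1 : \sum_a F a x ^+ 2 * (p * (1 + kap) * L + curv * u x ^+ 2)
    <= Lam * (p * (1 + kap) * L + curv * u x ^+ 2).
  rewrite -mulr_suml ler_wpM2r ?F2//.
  by apply: addr_ge0; do ?[by []|apply: mulr_ge0].
have h2 : \sum_a b a * (p * (1 + kap^-1) * u x ^+ 2) <=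
    B * (p * (1 + kap^-1) * u x ^+ 2).
  rewrite -mulr_suml ler_wpM2r ?FB//.
  by do ?[by []|apply: mulr_ge0].
rewrite -mulr_suml in h1; rewrite -mulr_suml in h2.
apply: le_trans (lerD h1 h2) _.
apply: (@le_trans _ _ (p * (1 + kap) * Lam * L +
    (p * (1 + kap^-1) * B + curv * Lam) * u x ^+ 2)).
  by rewrite le_eqVlt; apply/orP; left; apply/eqP; ring.
by rewrite lerD// ler_wpM2r.
Qed.

(** The masses m_a of the pieces are at most d / (2 - kap) and add up to at least
    (1 - kap) Lam d, so that the bound is [le_sum_powR] with t = d / (2 - kap). *)
Lemma balanced_mass_le (u : folland_stein R n) (d : R) : 0 < d ->
  {ae mu, forall x, 0 <= u x} ->
  (forall i, \int[mu]_(x in S) (x 0 i * u x `^ p) = 0) ->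
  (\int[mu]_(x in S) (`|u x| `^ p)%:E = d%:E)%E ->
  exists m : I -> R,
    (forall a, (\int[mu]_(x in S) (`|wF u a x| `^ p)%:E = (m a)%:E)%E) /\
    d `^ theta * ((2 - kap) / (2 - kap) `^ theta * (1 - kap) * Lam) <=
      \sum_a m a `^ theta.
Proof.
move=> d0 u0 bal hd; have mS := @measurable_sphere R n.
have dfin : (\int[mu]_(x in S) (`|u x| `^ p)%:E < +oo)%E by rewrite hd ltry.
have th0 : 0 < theta by rewrite divr_gt0// ltr0n.
have th1 : theta <= 1 by rewrite ler_pdivrMr// mul1r ler_nat.
have ME a : (\int[mu]_(x in S) (`|wF u a x| `^ p)%:E =
    \int[mu]_(x in S) (F a x `^ p * `|u x| `^ p)%:E)%E.
  apply: eq_integral => x _; have /andP[Fx0 _] := F01 a x.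
  by rewrite normrM (ger0_norm Fx0) powRM.
pose M a := (\int[mu]_(x in S) (F a x `^ p * `|u x| `^ p)%:E)%E.
have M0 a : (0 <= M a)%E.
  by apply: integral_ge0 => x _; rewrite lee_fin mulr_ge0 ?powR_ge0.
have Mhalf a : ((2 - kap)%:E * M a <= d%:E)%E.
  have [w hw] := Fw a; rewrite -hd; apply: (localized_mass_le u0 dfin bal k20 _ hw).
  by move=> x; exact: powR_ge0.
have Mfin a : M a \is a fin_num.
  rewrite ge0_fin_numE//; have := Mhalf a; rewrite -lee_pdivlMl// => /le_lt_trans.
  by apply; rewrite -EFinM ltry.
exists (fun a => fine (M a)); split=> [a|]; first by rewrite ME -/(M a) fineK.
have t0 : 0 < d / (2 - kap) by rewrite divr_gt0.
have mt a : 0 <= fine (M a) <= d / (2 - kap).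
  rewrite fine_ge0//= ler_pdivlMr// mulrC -lee_fin EFinM fineK//.
have th01 : 0 < theta <= 1 by rewrite th0.
apply: le_trans (le_sum_powR t0 th01 mt).
have Lk : 0 < (1 - kap) * Lam by rewrite mulr_gt0// subr_gt0.
have sumM : (1 - kap) * Lam * d <= \sum_a fine (M a).
  rewrite mulrC -ler_pdivlMr// mulrC -lee_fin EFinM -sumEFin.
  under eq_bigr do rewrite fineK//.
  rewrite /M -ge0_integral_sum//; last 2 first.
  - move=> a; apply/measurable_EFinP; apply: measurable_funM.
      apply: (measurableT_comp (measurable_powR _)); exact: measurable_C1_sphere.
    exact: measurable_powR_fs.
  - by move=> a x _; rewrite lee_fin mulr_ge0 ?powR_ge0.
  under eq_integral do rewrite sumEFin.
  rewrite -hd; apply: ge0_le_integral_scale; first by rewrite invr_gt0.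
    by move=> x _; exact: powR_ge0.
  move=> x sx; rewrite -mulr_suml mulrA ler_peMl ?powR_ge0//.
  by rewrite ler_pdivlMl// mulr1; exact: Fp.
apply: le_trans (_ : (d / (2 - kap)) `^ theta / (d / (2 - kap)) *
    ((1 - kap) * Lam * d) <= _); last first.
  by rewrite ler_wpM2l// divr_ge0 ?powR_ge0// ltW.
rewrite powRM ?(ltW d0) ?invr_ge0 ?(ltW k20)//.
have -> : (2 - kap)^-1 `^ theta = ((2 - kap) `^ theta)^-1.
  by rewrite -powR_inv1 ?(ltW k20)// powRAC powR_inv1 ?powR_ge0.
rewrite le_eqVlt; apply/orP; left; apply/eqP.
by field; rewrite !gt_eqF ?powR_gt0.
Qed.

(** If Y D^theta is infinite then so is the energy of u, by the Yamabe inequality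
    for u itself; otherwise D and Y are finite, or the left-hand side is 0. *)
Lemma balanced_improved (u : folland_stein R n) (co C : R) :
  let A := (2 - kap) / (2 - kap) `^ theta * (1 - kap) * Lam in
  0 < co -> 0 < C -> p * (1 + kap) * Lam <= A * co ->
  p * (1 + kap^-1) * B + curv * Lam <= A * C ->
  {ae mu, forall x, 0 <= u x} ->
  (forall i, \int[mu]_(x in S) (x 0 i * u x `^ p) = 0) ->
  (cr_yamabe_invariant R n *
     (\int[mu]_(x in S) (`|u x| `^ p)%:E) `^ theta <=
   \int[mu]_(x in S) (co * dirichlet_density u x + C * u x ^+ 2)%:E)%E.
Proof.
move=> A co0 C0 hco hC u0 bal; have p0 := @crit_exp_gt0 R n.
have W0 := @webster_curvature_ge0 R n.
have A0 : 0 < A.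
  by rewrite /A !mulr_gt0 ?invr_gt0 ?powR_gt0// subr_gt0.
have YN := yamabe_le u n0.
set D := (\int[mu]_(x in S) (`|u x| `^ p)%:E)%E in YN *.
set Y := cr_yamabe_invariant R n in YN *.
have Y0 : (0 <= Y)%E := cr_yamabe_invariant_ge0.
have D0 : (0 <= D)%E by apply: integral_ge0 => x _; rewrite lee_fin powR_ge0.
set X := (\int[mu]_(x in S) (co * _ + _)%:E)%E.
have X0 : (0 <= X)%E.
  apply: integral_ge0 => x _; rewrite lee_fin addr_ge0// mulr_ge0 ?sqr_ge0 ?(ltW co0) ?(ltW C0)//.
  exact: dirichlet_density_ge0.
have [YDy|YDy] := eqVneq (Y * D `^ theta)%E +oo%E.
  move: YN; rewrite YDy leye_eq => /eqP NE.
  (* K times the right-hand side dominates the energy of u *)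
  pose K := p / co + curv / C.
  have K0 : 0 < K by rewrite ltr_wpDr ?divr_gt0// divr_ge0// ltW.
  suff : (+oo <= K%:E * X)%E.
    rewrite leye_eq => /eqP KX; move: X0; case: (X) KX => [r|//|//].
    by rewrite -EFinM.
  rewrite -NE; apply: ge0_le_integral_scale => // x sx.
    rewrite addr_ge0// mulr_ge0 ?sqr_ge0 ?(ltW p0)//; exact: dirichlet_density_ge0.
  have := dirichlet_density_ge0 u x; have := sqr_ge0 (u x).
  set L := dirichlet_density u x; set u2 := u x ^+ 2 => u20 L0.
  have -> : K * (co * L + C * u2) = p * L + curv * u2 +
      (curv / C * (co * L) + p / co * (C * u2)).
    by rewrite /K; field; rewrite !gt_eqF.
  by rewrite lerDl; apply: addr_ge0; do ?[by []|exact: ltW|apply: mulr_ge0|rewrite invr_ge0].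
have th0 : 0 < theta by rewrite divr_gt0// ltr0n.
have [DE|Dn0] := eqVneq D 0%E; first by rewrite DE poweR0r ?gt_eqF// mule0.
have [YE|Yn0] := eqVneq Y 0%E; first by rewrite YE mul0e.
have Dpos : (0 < D)%E by rewrite lt_neqAle eq_sym Dn0.
have Ypos : (0 < Y)%E by rewrite lt_neqAle eq_sym Yn0.
have Dfin : D \is a fin_num.
  rewrite ge0_fin_numE// ltey; apply: contra YDy => /eqP ->.
  by rewrite poweRyr ?(gt_eqF th0)// gt0_muley.
have Yfin : Y \is a fin_num.
  rewrite ge0_fin_numE// ltey; apply: contra YDy => /eqP ->.
  by rewrite gt0_mulye// poweR_gt0.
have d0 : 0 < fine D by rewrite fine_gt0// Dpos ltey_eq Dfin.
have y0 : 0 <= fine Y by rewrite fine_ge0.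
have hd : (\int[mu]_(x in S) (`|u x| `^ p)%:E = (fine D)%:E)%E by rewrite fineK.
have [m [hm summ]] := balanced_mass_le d0 u0 bal hd.
rewrite -(fineK Yfin) -(fineK Dfin) poweR_EFin -EFinM.
rewrite -(@lee_pmul2l _ A%:E)// -EFinM.
(* lower bound by the masses, then the Yamabe inequality for each piece *)
apply: (@le_trans _ _ (\sum_a (fine Y * m a `^ theta)%:E)%E).
  rewrite sumEFin lee_fin -mulr_sumr mulrCA [A * _]mulrC ler_wpM2l//.
apply: (@le_trans _ _ (\sum_a \int[mu]_(x in S)
    (p * dirichlet_density (wF u a) x + curv * wF u a x ^+ 2)%:E)%E).
  apply: lee_sum => a _; have := yamabe_le (wF u a) n0.
  by rewrite hm -/Y -(fineK Yfin) poweR_EFin -EFinM.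
apply: le_trans (sum_energy_le u (mulr_gt0 A0 co0) (mulr_gt0 A0 C0) hco hC) _.
apply: ge0_le_integral_scale => // x sx; last first.
  rewrite le_eqVlt; apply/orP; left; apply/eqP.
  by move: (dirichlet_density u x) => L; ring.
by apply: addr_ge0; do ?[exact: dirichlet_density_ge0|exact: sqr_ge0|exact: ltW
  |apply: mulr_ge0].
Qed.

End localized_yamabe.

(** * The improved inequality *)

Theorem lemma6p1 (R : realType) (n : nat) (hn : (1 <= n)%N)
    (eps : R) (heps : 0 < eps) :
  exists C : R, forall u : folland_stein R n,
    {ae dV R n, forall x, 0 <= u x} ->
    (forall i : 'I_n.+1,
      sphere_cintegral (fun x => zcoord i x * (u x `^ crit_exp R n)%:C)%C = 0 /\
      sphere_cintegral (fun x => conjc (zcoord i x) * (u x `^ crit_exp R n)%:C)%C = 0) ->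
    (cr_yamabe_invariant R n
       * (\int[dV R n]_(x in sphere R n) (u x `^ crit_exp R n)%:E)
           `^ (n%:R / n.+1%:R)
     <= (2 `^ (- n.+1%:R^-1) * ((2 * n + 2)%:R / n%:R) + eps)%:E
          * \int[dV R n]_(x in sphere R n) (dirichlet_density u x)%:E
        + C%:E * \int[dV R n]_(x in sphere R n) (u x ^+ 2)%:E)%E.
Proof.
set s : R := n.+1%:R^-1; set p := crit_exp R n.
have nR0 : (n%:R : R) != 0 by rewrite pnatr_eq0 -lt0n.
have pE : (2 * n + 2)%:R / n%:R = p.
  by rewrite /p /crit_exp natrD natrM; field.
rewrite pE; set c0 := 2 `^ (- s) * p.
have p0 : 0 < p := crit_exp_gt0.
have c00 : 0 < c0 by rewrite mulr_gt0// powR_gt0.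
have s01 : 0 < s <= 1 by rewrite invr_gt0 ltr0n/= invf_le1 ?ltr0n// ler1n.
have thE : n%:R / n.+1%:R = 1 - s.
  by rewrite /s -natr1; field; rewrite natr1 pnatr_eq0.
pose kap : R := Num.min 4^-1 (eps / (8 * c0)).
have kap0 : 0 < kap by rewrite lt_min invr_gt0 ltr0n divr_gt0// mulr_gt0.
have kap4 : kap <= 4^-1 by rewrite ge_min lexx.
have kape : 8 * kap * c0 <= eps.
  rewrite mulrAC mulrC -ler_pdivlMr ?mulr_gt0//.
  by rewrite ge_min lexx orbT.
have kap1 : kap < 1 by lra.
have [|I [F [Lam [Lam0 cmF F01 F2p Fw]]]] := @localizing_family R n p kap.
  by rewrite kap0.
have /choice[b hb] : forall a, exists b : R, forall x, sphere R n x ->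
    levi x (subgradient (F a) x) (subgradient (F a) x) <= b.
  by move=> a; have [b _ hb] := subgradient_bounded (cmF a).1; exists b.
pose B := \sum_a b a.
pose A := (2 - kap) / (2 - kap) `^ (n%:R / n.+1%:R) * (1 - kap) * Lam.
have A0 : 0 < A by rewrite /A !mulr_gt0 ?invr_gt0 ?powR_gt0//; lra.
(* the absolute value makes the constant positive whatever the sign of B *)
pose C1 := `|p * (1 + kap^-1) * B + @webster_curvature R n * Lam| + 1.
have C10 : 0 < C1 by rewrite ltr_pwDr.
exists (C1 / A) => u u0 bal.
have co0 : 0 < c0 + eps by rewrite addr_gt0.
have balR i : \int[dV R n]_(x in sphere R n) (x 0 i * u x `^ p) = 0.
  case: (split_ordP i) => j ->.
    have /(congr1 (fun z => complex.Re z))/= <- := (bal j).1.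
    by apply: eq_Rintegral => x _; rewrite mulr0 subr0.
  have /(congr1 (fun z => complex.Im z))/= <- := (bal j).1.
  by apply: eq_Rintegral => x _; rewrite mulr0 add0r.
have C0 : 0 < C1 / A by rewrite divr_gt0.
rewrite integral_powR_norm1// -(integral_quadratic u (ltW co0) (ltW C0)).

apply: (balanced_improved (F := F) (Lam := Lam) (kap := kap) (B := B)) => //.
- by move=> a; exact: (cmF a).1.
- by move=> a; exact: (cmF a).2.
- by move=> x sx; case: (F2p x sx).
- by move=> x sx; case: (F2p x sx).
- exact: Fw.
- by move=> x sx; apply: ler_sum => a _; exact: hb.
- rewrite thE [X in _ <= X]mulrAC ler_pM2r//.
  by apply: localized_constant_le => //; rewrite kap0.
- by rewrite [X in _ <= X]mulrC divfK ?gt_eqF// (le_trans (ler_norm _))// lerDl.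
Qed.
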